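(* Let $A=C([0,1])$ and set $\mathcal N=\ell_2(A)$. There exist uncountably many pairs $(\mathcal M_\alpha,r_\alpha)$, indexed by a set $I$ of cardinality continuum, such that for each $\alpha\in I$: (i) $\mathcal M_\alpha$ is a full Hilbert $A$-submodule of $\mathcal N$ with $(\mathcal M_\alpha)^\perp=\{0\}$ in $\mathcal N$; (ii) $r_\alpha:\mathcal N\to A$ is a non-zero bounded $A$-linear functional with $r_\alpha|_{\mathcal M_\alpha}=0$; (iii) $r_\alpha$ is non-degenerate, $Ar_\alpha\cap\mathcal N=\{0\}$ in $\mathcal N'$, and $\mathrm{Ker}(r_\alpha)$ is norm-closed but not biorthogonally complemented in $\mathcal N$; (iv) for $\alpha\neq\beta$ in $I$, the pairs $(\mathcal M_\alpha,r_\alpha)$ and $(\mathcal M_\beta,r_\beta)$ are not unitarily isomorphic, in the sense that there is no unitary $U$ in the C*-algebra of bounded adjointable operators on $\mathcal N$ with $U(\mathcal M_\alpha)=\mathcal M_\beta$ and $r_\beta=r_\alpha\circ U^{-1}$. In particular, there are uncountably many mutually non-isomorphic (in the sense of (iv)) Kaad--Skeide type examples $(\mathcal M_Q,r_Q)$ attached to different dense subsets $Q$ of $[0,1]$.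
   Context: Hilbert $A$-modules are left modules, complete in norm, with $A$-valued inner product $\langle\cdot,\cdot\rangle$ that is $A$-linear in the first entry. $\ell_2(A)$ is the standard countably generated Hilbert $A$-module with $\langle (x_i),(y_i)\rangle=\sum_i x_iy_i^*$. For a subset $\mathcal M\subseteq\mathcal N$, $\mathcal M^\perp=\{n\in\mathcal N:\langle n,m\rangle=0\ \forall m\in\mathcal M\}$. A Hilbert $A$-module is full if the closed linear span of its inner product values is $A$. A norm-closed submodule $\mathcal K\subseteq\mathcal N$ is biorthogonally complemented if $\mathcal K=\mathcal K^{\perp\perp}$. $\mathcal N'$ denotes the Banach $A$-module of all bounded $A$-linear maps $\mathcal N\to A$, with the left action $(ar)(n)=r(n)a^*$, so that $\mathcal N$ embeds isometrically and $A$-linearly in $\mathcal N'$ by $x\mapsto\langle\cdot,x\rangle$. Put $Ar=\{ar:a\in A\}\subseteq\mathcal N'$. The functional $r$ is non-degenerate if, for $a\in A$, $ar=0$ if and only if $a=0$. Kaad--Skeide type examples: let $Q=\{q_k:k\in\mathbb N\}\subset(0,1)$ be a countable set that is dense in $[0,1]$. Decompose $\ell_2(A)=A\oplus\ell_2(A)_{(1)}\oplus\ell_2(A)_{(2)}\oplus\cdots$ as an orthogonal sum, with $e_{(0)}$ the unit of the first summand $A$ and $\{e_{(k),\ell}\}_{\ell\ge1}$ the standard orthonormal basis of $\ell_2(A)_{(k)}$, a copy of $\ell_2(A)$. For $q\in(0,1)$ let $\psi_{q,\ell}\ge 0$ ($\ell\ge1$) be the functions in $A$ such that: $\psi_{q,1}^2$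 falls linearly from $1$ at $0$ to $0$ at $q/2$ and is $0$ on $[q/2,1]$; for $\ell\ge2$, $\psi_{q,\ell}^2$ is zero on $[0,(\ell-2)q/(\ell-1)]\cup[\ell q/(\ell+1),1]$, rises linearly from $0$ to $1$ on $[(\ell-2)q/(\ell-1),(\ell-1)q/\ell]$ and falls linearly from $1$ to $0$ on $[(\ell-1)q/\ell,\ell q/(\ell+1)]$. Thus $\sum_\ell\psi_{q,\ell}^2=\chi_{[0,q)}$ pointwise. The submodule $\mathcal M_Q$ is the norm-closed $A$-submodule of $\ell_2(A)$ generated by the elements $2^{-k}\psi_{q_k,\ell}\,e_{(0)}-e_{(k),\ell}$, $k,\ell\in\mathbb N$, and $r_Q:\ell_2(A)\to A$ is defined by $r_Q\big((a_{(0)},a_{(k),\ell})\big)=a_{(0)}+\sum_{k\ge1}2^{-k}\sum_{\ell\ge1}a_{(k),\ell}\,\psi_{q_k,\ell}^*$. *)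

(* Defs.v *)
From HB Require Import structures.
From mathcomp Require Import all_boot all_order all_algebra.
From mathcomp Require Import all_classical all_reals all_analysis.
From mathcomp Require Import complex ring lra.
Set Implicit Arguments. Unset Strict Implicit. Unset Printing Implicit Defensive.
Import Order.TTheory GRing.Theory Num.Theory numFieldNormedType.Exports.
Local Open Scope classical_set_scope.
Local Open Scope ring_scope.
Local Open Scope complex_scope.
Import Normc.

(* An alias of R[i] that carries the topology of its norm; R[i] itself already
   has an lmodule structure over R, which would clash with the one over R[i]. *)
Definition Cx (R : realType) : Type := R[i].
HB.instance Definition _ (R : realType) := Num.ClosedField.copy (Cx R) R[i].
HB.instance Definition _ (R : realType) := GRing.ComAlgebra.copy (Cx R) (Cx R)^o.
HB.instance Definition _ (R : realType) := NormedModule.copy (Cx R) (Cx R)^o.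

Definition I01 (R : realType) : Type := set_type (`[0, 1]%classic : set R).
HB.instance Definition _ (R : realType) := Topological.copy (I01 R) (set_type (`[0, 1]%classic : set R)).

Section cplx.
Variable R : realType.
Implicit Types z : Cx R.

Lemma normCE z : `|z| = (normc z)%:C :> R[i].
Proof. by case: z. Qed.

Lemma normc_ge0 z : 0 <= normc z :> R.
Proof. by case: z => a b; exact: sqrtr_ge0. Qed.

Lemma normc_ltP z (e : R) : (normc z < e) = (`|z| < (e%:C : Cx R)).
Proof. by rewrite -ltcR normCE. Qed.

Lemma pos_normP (e : Cx R) : 0 < e -> exists2 d : R, 0 < d & e = d%:C.
Proof.
case: e => a b; rewrite ltcE => /andP[/eqP /= -> a0]; by exists a.
Qed.

Lemma cvgCP (T : topologicalType) (F : set_system T) {FF : Filter F} (f : T -> Cx R) (l : Cx R) :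
  f @ F --> l <-> (forall e : R, 0 < e -> \forall t \near F, normc (l - f t) < e).
Proof.
split.
  move/cvgrPdist_lt => h e e0; have := h (e%:C); rewrite ltcR => /(_ e0).
  by apply: filterS => t; rewrite normc_ltP.
move=> h; apply/cvgrPdist_lt => e /pos_normP[d d0 ->].
by apply: filterS (h d d0) => t; rewrite normc_ltP.
Qed.

Lemma near_normc z (e : R) : 0 < e -> \forall w \near z, normc (z - w) < e.
Proof. by move=> e0; apply: (cvgCP (F := nbhs z) id z).1 => //; exact: cvg_id. Qed.

Lemma I01_compact : compact [set: I01 R].
Proof.
move=> F PF _.
have F01 : ((set_val : I01 R -> R) @ F) `[0, 1]%classic.
  by apply: (@filterS _ F _ setT) => [x _|]; [exact: set_valP|exact: filterT].
have [p [p01 clp]] := @segment_compact R 0 1 _ _ F01.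
exists (@exist _ _ p (mem_set p01)); split => // A B FA.
rewrite nbhsE => -[B' [[C oC <-] /= Cp] CB].
have [||y [[x Ax xy] Cy]] := clp (set_val @` A) C.
- by apply: (@filterS _ F _ A) => // x Ax; exists x.
- exact: open_nbhs_nbhs.
by exists x; split=> //; apply: CB => /=; rewrite xy.
Qed.

Lemma normc_continuous : continuous (fun z : Cx R => normc z : R).
Proof.
move=> z; apply: (@cvgrPdist_lt _ R _ (nbhs z) _ _ _).2 => e e0.
apply: (@filterS _ (nbhs z) (nbhs_filter z) _ _ _ (near_normc z e0)) => w; apply: le_lt_trans.
have E : forall x y : Cx R, normc x - normc y <= normc (x - y).
  by move=> a b; rewrite lerBlDr; have := @le_normcD R (a - b) b; rewrite subrK.
apply/ler_normlP; split; last exact: E.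
by rewrite opprB -(normcN (z - w)) opprB; exact: E.
Qed.

Lemma real_complex_continuous : continuous (fun x : R => x%:C : Cx R).
Proof.
move=> x; apply/cvgCP => e e0.
have := (@cvgrPdist_lt _ R _ (nbhs x) _ id x).1 cvg_id _ e0.
move=> /(_ (nbhs_filter x)); apply: (@filterS _ (nbhs x) (nbhs_filter x)) => w.
by rewrite -rmorphB /normc/= expr0n /= addr0 sqrtr_sqr.
Qed.

Lemma conjc_continuous : continuous (fun z : Cx R => conjc z : Cx R).
Proof.
move=> x; apply: (cvgCP (F := nbhs x) _ _).2 => e e0.
apply: (@filterS _ (nbhs x) (nbhs_filter x) _ _ _ (near_normc x e0)) => w.
by rewrite -rmorphB; case: (x - w) => a b /=; rewrite sqrrN.
Qed.
End cplx.

(* The C*-algebra C([0,1]) of complex-valued functions: comAlgType over Cx R,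
   involution C01_star, and the sup norm, with values in R. *)
Record C01 (R : realType) := MkC01 {
  C01_fun :> I01 R -> Cx R ;
  C01_continuous : continuous C01_fun }.

HB.instance Definition _ (R : realType) := gen_eqMixin (C01 R).
HB.instance Definition _ (R : realType) := gen_choiceMixin (C01 R).

Section C01_alg.
Variable R : realType.
Implicit Types f g h : C01 R.

Lemma C01_eqP f g : (forall t, f t = g t) -> f = g.
Proof.
case: f g => [f cf] [g cg] /= /funext E; rewrite -E in cg *.
congr MkC01; exact: Prop_irrelevance.
Qed.

Let addcont f g : continuous (fun t => f t + g t).
Proof. by move=> t; exact: (@continuousD _ (Cx R) _ f g t (@C01_continuous R f t) (@C01_continuous R g t)). Qed.
Let oppcont f : continuous (fun t => - f t).
Proof. by move=> t; exact: (@continuousN _ (Cx R) _ f t (@C01_continuous R f t)). Qed.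
Let mulcont f g : continuous (fun t => f t * g t).
Proof. by move=> t; exact: (@continuousM (Cx R) _ f g t (@C01_continuous R f t) (@C01_continuous R g t)). Qed.
Let starcont f : continuous (fun t => conjc (f t) : Cx R).
Proof.
move=> t; exact: (@continuous_comp _ _ _ f (fun z : Cx R => conjc z : Cx R) t (@C01_continuous R f t) (@conjc_continuous R (f t))).
Qed.
Let cstcont (c : Cx R) : continuous (fun _ : I01 R => c).
Proof. exact: cst_continuous. Qed.

Definition C01_cst c := MkC01 (@cstcont c).
Definition C01_add f g := MkC01 (@addcont f g).
Definition C01_opp f := MkC01 (@oppcont f).
Definition C01_mul f g := MkC01 (@mulcont f g).
Definition C01_star f := MkC01 (@starcont f).

Let addA : associative C01_add. Proof. by move=> f g h; apply/C01_eqP => t; exact: addrA. Qed.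
Let addC : commutative C01_add. Proof. by move=> f g; apply/C01_eqP => t; exact: addrC. Qed.
Let add0 : left_id (C01_cst 0) C01_add. Proof. by move=> f; apply/C01_eqP => t; exact: add0r. Qed.
Let addN : left_inverse (C01_cst 0) C01_opp C01_add. Proof. by move=> f; apply/C01_eqP => t; exact: addNr. Qed.
HB.instance Definition _ := GRing.isZmodule.Build (C01 R) addA addC add0 addN.

Let mulA : associative C01_mul. Proof. by move=> f g h; apply/C01_eqP => t; exact: mulrA. Qed.
Let mulC : commutative C01_mul. Proof. by move=> f g; apply/C01_eqP => t; exact: mulrC. Qed.
Let mul1 : left_id (C01_cst 1) C01_mul. Proof. by move=> f; apply/C01_eqP => t; exact: mul1r. Qed.
Let mulD : left_distributive C01_mul +%R. Proof. by move=> f g h; apply/C01_eqP => t; exact: mulrDl. Qed.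

Lemma I01_zero_subproof : (0 : R) \in `[0, 1]%classic.
Proof. by rewrite inE /= in_itv /= lexx ler01. Qed.
Definition I01_zero : I01 R := exist _ (0 : R) I01_zero_subproof.

Let one_neq0 : C01_cst 1 != 0.
Proof. by apply/eqP => /(congr1 (fun f => C01_fun f I01_zero)) /= /eqP; rewrite oner_eq0. Qed.
HB.instance Definition _ := GRing.Zmodule_isComNzRing.Build (C01 R) mulA mulC mul1 mulD one_neq0.

Definition C01_scale (c : Cx R) f := C01_cst c * f.
Let scaleA a b f : C01_scale a (C01_scale b f) = C01_scale (a * b) f.
Proof. by apply/C01_eqP => t; exact: mulrA. Qed.
Let scale1 : left_id 1 C01_scale. Proof. by move=> f; apply/C01_eqP => t; exact: mul1r. Qed.
Let scaleDr : right_distributive C01_scale +%R. Proof. by move=> a f g; apply/C01_eqP => t; exact: mulrDr. Qed.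
Let scaleDl f : {morph C01_scale^~ f : a b / a + b}. Proof. by move=> a b; apply/C01_eqP => t; exact: mulrDl. Qed.
HB.instance Definition _ := GRing.Zmodule_isLmodule.Build (Cx R) (C01 R) scaleA scale1 scaleDr scaleDl.
Let scaleAl (a : Cx R) f g : a *: (f * g) = a *: f * g.
Proof. exact: mulrA. Qed.
HB.instance Definition _ := GRing.Lmodule_isLalgebra.Build (Cx R) (C01 R) scaleAl.
HB.instance Definition _ := GRing.Lalgebra_isComAlgebra.Build (Cx R) (C01 R).

Definition C01_norm f : R := sup (range (fun t => normc (f t))).

Let norm_cont f : continuous (fun t => normc (f t)).
Proof.
move=> t; exact: (@continuous_comp _ _ _ f (fun z : Cx R => normc z : R) t (@C01_continuous R f t) (@normc_continuous R (f t))).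
Qed.

Lemma C01_norm_has_sup f : has_sup (range (fun t => normc (f t))).
Proof.
split; first by exists (normc (f I01_zero)), I01_zero.
have : compact (range (fun t => normc (f t))).
  apply: continuous_compact; last exact: I01_compact.
  exact/continuous_subspaceT/norm_cont.
move=> /compact_bounded[M [_ /(_ (M + 1))]]; rewrite ltrDl ltr01 => /(_ isT) h.
exists (M + 1) => _ [t _ <-]; apply: le_trans (ler_norm _) _; apply: h; by exists t.
Qed.

Lemma C01_norm_ge f t : normc (f t) <= C01_norm f.
Proof. by apply: ub_le_sup; [case: (C01_norm_has_sup f)|exists t]. Qed.
Lemma C01_norm_le f (e : R) : (forall t, normc (f t) <= e) -> C01_norm f <= e.
Proof. by move=> h; apply: ge_sup; [case: (C01_norm_has_sup f)|move=> _ [t _ <-]]. Qed.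

Let normD f g : C01_norm (f + g) <= C01_norm f + C01_norm g.
Proof. by apply: C01_norm_le => t; apply: le_trans (le_normcD _ _) _; apply: lerD; exact: C01_norm_ge. Qed.
Let norm0 f : C01_norm f = 0 -> f = 0.
Proof.
move=> f0; apply/C01_eqP => t; apply: eq0_normc; apply/eqP.
by rewrite eq_le -{1}f0 C01_norm_ge normc_ge0.
Qed.
Lemma C01_natE f n t : (f *+ n) t = f t *+ n.
Proof. by elim: n => // n IH; rewrite !mulrS -IH. Qed.
Let normMn f n : C01_norm (f *+ n) = C01_norm f *+ n.
Proof.
case: n => [|n].
  rewrite !mulr0n; apply/eqP; rewrite eq_le; apply/andP; split.
    by apply: C01_norm_le => t; rewrite normc0.
  by apply: le_trans (C01_norm_ge _ I01_zero); rewrite normc_ge0.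
apply/eqP; rewrite eq_le; apply/andP; split.
  by apply: C01_norm_le => t; rewrite C01_natE normcMn lerMn2r C01_norm_ge.
rewrite -mulr_natr -ler_pdivlMr ?ltr0n//; apply: C01_norm_le => t.
by rewrite ler_pdivlMr ?ltr0n// mulr_natr -normcMn -C01_natE C01_norm_ge.
Qed.
Let normN f : C01_norm (- f) = C01_norm f.
Proof. by congr sup; apply/seteqP; split => _ [t _ <-]; exists t => //=; rewrite normcN. Qed.
HB.instance Definition _ := Num.Zmodule_isNormed.Build R (C01 R) normD norm0 normMn normN.
HB.instance Definition _ := PseudoMetric.copy (C01 R) (pseudoMetric_normed (C01 R)).
HB.instance Definition _ := isPointed.Build (C01 R) 0.
HB.instance Definition _ := NormedZmod_PseudoMetric_eq.Build R (C01 R) erefl.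
End C01_alg.

Section complete.
Variable R : realType.

Lemma normc_le_ReIm (z : Cx R) : normc z <= `|complex.Re z| + `|complex.Im z|.
Proof.
case: z => a b /=; rewrite -[leRHS]ger0_norm ?addr_ge0// -sqrtr_sqr ler_wsqrtr//.
by rewrite sqrrD !real_normK ?num_real// lerD2r lerDl mulrn_wge0// mulr_ge0.
Qed.
Lemma normc_ge_ReIm (z : Cx R) : `|complex.Re z| <= normc z /\ `|complex.Im z| <= normc z.
Proof.
case: z => a b /=; rewrite -!sqrtr_sqr; split; rewrite ler_wsqrtr//.
  by rewrite lerDl sqr_ge0.
by rewrite lerDr sqr_ge0.
Qed.

Lemma Cx_complete (F : set_system (Cx R)) : ProperFilter F -> cauchy F -> cvg F.
Proof.
move=> PF /cauchyP Fc.
have part (g : Cx R -> R) : (forall z w, `|g z - g w| <= normc (z - w)) ->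
    exists l : R, g @ F --> l.
  move=> gl; apply: (cvg_ex (g @ F)).1; apply: R_complete; apply: (cauchyP (g @ F)).2 => e e0.
  have [|z Fz] := Fc e%:C; first by rewrite ltcR.
  exists (g z); apply: (@filterS _ F _ _ _ _ Fz) => w zw.
  apply: le_lt_trans (gl _ _) _.
  by rewrite normc_ltP.
have [z w|a /(@cvgrPdist_lt _ R)ca] := part (@complex.Re R).
  by rewrite -raddfB; have [] := normc_ge_ReIm (z - w).
have [z w|b /(@cvgrPdist_lt _ R)cb] := part (@complex.Im R).
  by rewrite -raddfB; have [] := normc_ge_ReIm (z - w).
apply/cvg_ex; exists (a +i* b : Cx R).
apply: (cvgCP (F := F) id _).2 => e e0.
have e20 : 0 < e / 2 by rewrite divr_gt0.
apply: filterS2 (ca _ e20) (cb _ e20) => -[x y] xa yb.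
apply: le_lt_trans (normc_le_ReIm _) _.
by rewrite [ltRHS]splitr ltrD.
Qed.
HB.instance Definition _ := Uniform_isComplete.Build (Cx R) Cx_complete.

Lemma C01_complete (F : set_system (C01 R)) : ProperFilter F -> cauchy F -> cvg F.
Proof.
move=> PF /cauchyP Fc.
have pt t : exists l : Cx R, (fun f : C01 R => f t) @ F --> l.
  pose G := (fun f : C01 R => f t) @ F.
  apply: (cvg_ex G).1; apply: Cx_complete; apply: (cauchyP G).2 => _ /pos_normP[e e0 ->].
  have [f Ff] := Fc _ e0; exists (f t); apply: (@filterS _ F _ _ _ _ Ff) => g fg.
  rewrite /ball/= -normc_ltP; apply: le_lt_trans fg; exact: (C01_norm_ge (f - g)).
have [l cl] := choice pt.
have unif (e : R) : 0 < e -> F [set f : C01 R | forall t, normc (l t - f t) <= e].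
  move=> e0; have e20 : 0 < e / 2 by rewrite divr_gt0.
  have [f Ff] := Fc _ e20; apply: (@filterS _ F _ _ _ _ Ff) => g fg t /=.
  apply/ler_addgt0Pl => d d0.
  have near_t : \near F, normc (l t - (F : C01 R) t) < d.
    exact: ((cvgCP (F := F) _ _).1 (cl t)).
  have [h [/= ht fh]] := filter_ex (filterI near_t Ff).
  have -> : l t - g t = (l t - h t) + (- (f - h) t + (f - g) t).
    by rewrite /= opprB; ring.
  apply: le_trans (le_normcD _ _) _; apply: lerD; first exact: ltW.
  rewrite [leRHS]splitr; apply: le_trans (le_normcD _ _) _; apply: lerD.
    by rewrite normcN; apply: le_trans (C01_norm_ge _ _) (ltW fh).
  exact: le_trans (C01_norm_ge _ _) (ltW fg).
have lc : continuous l.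
  move=> t; apply: (cvgCP (F := nbhs t) _ _).2 => e e0.
  have e30 : 0 < e / 3 by rewrite divr_gt0.
  have [f ft] := filter_ex (unif _ e30).
  have near_t : \forall s \near t, normc (f t - f s) < e / 3.
    exact: ((cvgCP (F := nbhs t) _ _).1 (@C01_continuous R f t)).
  apply: (@filterS _ (nbhs t) _ _ _ _ near_t) => s fts.
  have -> : l t - l s = (l t - f t) + ((f t - f s) - (l s - f s)) by ring.
  apply: le_lt_trans (le_normcD _ _) _.
  have -> : e = e / 3 + (e / 3 + e / 3) by field.
  apply: ler_ltD => //; apply: le_lt_trans (le_normcD _ _) _.
  by rewrite normcN ltr_leD.
apply/cvg_ex; exists (MkC01 lc); apply: (cvgrPdist_le (F := F) id _).2 => e e0.
apply: filterS (unif _ e0) => f fl; exact: C01_norm_le.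
Qed.
HB.instance Definition _ := Uniform_isComplete.Build (C01 R) C01_complete.
End complete.

Definition ell2_summable (R : realType) (x : nat -> C01 R) : Prop :=
  cvgn (series (fun i => x i * C01_star (x i))).

(* The standard module over A = C01 R, as an lmodType over A with the norm
   `|x| = sqrt `|<x, x>|; summability is norm convergence in A. *)
Record ell2 (R : realType) := MkEll2 {
  ell2_fun :> nat -> C01 R ;
  ell2_summableP : ell2_summable ell2_fun }.
Arguments ell2_summableP {R} _.

HB.instance Definition _ (R : realType) := gen_eqMixin (ell2 R).
HB.instance Definition _ (R : realType) := gen_choiceMixin (ell2 R).

Section ell2_mod.
Variable R : realType.
Implicit Types (x y : nat -> C01 R) (f g : C01 R) (t : I01 R).

Let nsq x t i : R := normc (x i t) ^+ 2.
Let S x := series (fun i => x i * C01_star (x i)) : nat -> C01 R.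
Let tail x m n : C01 R := \sum_(m <= i < n) x i * C01_star (x i).

Lemma C01_sumE (I : Type) (r : seq I) (P : pred I) (F : I -> C01 R) t :
  (\sum_(i <- r | P i) F i) t = \sum_(i <- r | P i) F i t.
Proof. by elim/big_rec2: _ => // i a b _ <-. Qed.

Lemma mul_conjc (z : Cx R) : z * conjc z = (normc z ^+ 2)%:C.
Proof. by rewrite -sqr_normc normCE -rmorphXn. Qed.

Let tailE x m n t : tail x m n t = (\sum_(m <= i < n) nsq x t i)%:C.
Proof. by rewrite C01_sumE rmorph_sum; apply: eq_bigr => i _; exact: mul_conjc. Qed.

Let nsq_ge0 x t i : 0 <= nsq x t i. Proof. exact: sqr_ge0. Qed.

Lemma normc_real (a : R) : normc (a%:C : Cx R) = `|a|.
Proof. by rewrite /= expr0n addr0 sqrtr_sqr. Qed.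

Let tail_normE x m n t : normc (tail x m n t) = \sum_(m <= i < n) nsq x t i.
Proof. by rewrite tailE normc_real ger0_norm// sumr_ge0. Qed.

Let tail_norm x m n t : \sum_(m <= i < n) nsq x t i <= `|tail x m n|.
Proof. by rewrite -tail_normE; exact: C01_norm_ge. Qed.

Lemma normc_sqD (s : R) (a b : Cx R) : 0 < s ->
  normc (a + b) ^+ 2 <= (1 + s) * normc a ^+ 2 + (1 + s^-1) * normc b ^+ 2.
Proof.
move=> s0; set u := normc a; set v := normc b.
have ab : normc (a + b) <= u + v by exact: le_normcD.
apply: (@le_trans _ _ ((u + v) ^+ 2)).
  by rewrite lerXn2r// ?nnegrE ?addr_ge0 ?normc_ge0.
rewrite -subr_ge0.
have -> : (1 + s) * u ^+ 2 + (1 + s^-1) * v ^+ 2 - (u + v) ^+ 2 = s^-1 * (s * u - v) ^+ 2.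
  by field; rewrite gt_eqF.
by rewrite mulr_ge0 ?invr_ge0 ?sqr_ge0// ltW.
Qed.

Let tailD (s : R) x y m n : 0 < s ->
  `|tail (fun i => x i + y i) m n| <= (1 + s) * `|tail x m n| + (1 + s^-1) * `|tail y m n|.
Proof.
move=> s0; apply: C01_norm_le => t; rewrite tail_normE.
apply: (@le_trans _ _ (\sum_(m <= i < n) ((1 + s) * nsq x t i + (1 + s^-1) * nsq y t i))).
  by apply: ler_sum => i _; exact: normc_sqD.
by rewrite big_split /= -!mulr_sumr lerD// ler_wpM2l// ?tail_norm// addr_ge0// ?invr_ge0 ltW.
Qed.

Let tailZ f x m n : `|tail (fun i => f * x i) m n| <= `|f| ^+ 2 * `|tail x m n|.
Proof.
apply: C01_norm_le => t; rewrite tail_normE.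
apply: (@le_trans _ _ (`|f| ^+ 2 * \sum_(m <= i < n) nsq x t i)); last first.
  by rewrite ler_wpM2l ?sqr_ge0.
rewrite mulr_sumr; apply: ler_sum => i _.
rewrite /nsq /= normcM exprMn ler_wpM2r ?sqr_ge0//.
by rewrite lerXn2r// ?nnegrE ?normc_ge0// C01_norm_ge.
Qed.

Let S0 x n : S x n = tail x 0 n. Proof. by []. Qed.

Let tailB x m n : (m <= n)%N -> S x n - S x m = tail x m n.
Proof.
by move=> mn; rewrite !S0 /tail (big_cat_nat _ mn)//= addrAC subrr add0r.
Qed.

Let tail_lt x : ell2_summable x -> forall e : R, 0 < e ->
  exists N, forall n, (N <= n)%N -> forall m, (N <= m <= n)%N -> `|tail x m n| < e.
Proof.
move=> /cvg_ex[l /cvgrPdist_lt cl] e e0.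
have [|N _ NP] := cl (e / 2); first by rewrite divr_gt0.
exists N => n Nn m /andP[Nm mn]; rewrite -tailB//.
have -> : S x n - S x m = (l - S x m) - (l - S x n) by ring.
by apply: le_lt_trans (ler_normB _ _) _; rewrite [ltRHS]splitr ltrD//; apply: NP => /=.
Qed.

Let lt_summable x : (forall e : R, 0 < e ->
  exists N, forall n, (N <= n)%N -> `|tail x N n| < e) -> ell2_summable x.
Proof.
move=> h; apply: cauchy_cvg; apply: cauchy_exP => e /h[N NP].
exists (S x N), N => // n /= Nn; rewrite -ball_normE /ball_ /= distrC.
by rewrite (tailB _ Nn); exact: NP.
Qed.

Let summableD x y : ell2_summable x -> ell2_summable y -> ell2_summable (fun i => x i + y i).
Proof.
move=> /tail_lt cx /tail_lt cy; apply: lt_summable => e e0.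
have e40 : 0 < e / 4 by rewrite divr_gt0.
have [N NP] := cx _ e40; have [M MP] := cy _ e40.
exists (maxn N M) => n; rewrite geq_max => /andP[Nn Mn].
apply: le_lt_trans (@tailD 1 _ _ _ _ ltr01) _.
have := NP _ Nn (maxn N M); have := MP _ Mn (maxn N M).
rewrite leq_maxl leq_maxr geq_max Nn Mn invr1 => /(_ isT) + /(_ isT).
lra.
Qed.

Let summableZ f x : ell2_summable x -> ell2_summable (fun i => f * x i).
Proof.
move=> /tail_lt cx; apply: lt_summable => e e0.
have c0 : 0 < `|f| ^+ 2 + 1 by rewrite ltr_wpDl// sqr_ge0.
have [|N NP] := cx (e / (`|f| ^+ 2 + 1)); first by rewrite divr_gt0.
exists N => n Nn; apply: le_lt_trans (tailZ _ _ _ _) _.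
have := NP n Nn N; rewrite leqnn Nn => /(_ isT).
rewrite ltr_pdivlMr//; apply: le_lt_trans.
by rewrite mulrDr mulr1 mulrC lerDl.
Qed.

Let tail0 m n : tail (fun=> 0) m n = 0.
Proof. by rewrite /tail big1// => i _; rewrite mul0r. Qed.

Let summable0 : ell2_summable (fun=> 0 : C01 R).
Proof. by apply: lt_summable => e e0; exists 0%N => n _; rewrite tail0 normr0. Qed.

Let summableN x : ell2_summable x -> ell2_summable (fun i => - x i).
Proof.
move=> /(@summableZ (-1)); congr ell2_summable; apply/funext => i; exact: mulN1r.
Qed.

Let summable_delta j : ell2_summable (fun i => if i == j then 1 else 0 : C01 R).
Proof.
apply: lt_summable => e e0; exists j.+1 => n _.
rewrite /tail big_nat_cond big1 ?normr0// => i /andP[/andP[ji _] _].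
by rewrite gtn_eqF// mul0r.
Qed.

Lemma ell2_eqP (u v : ell2 R) : (forall i, u i = v i) -> u = v.
Proof.
case: u v => [u cu] [v cv] /= /funext E; rewrite -E in cv *.
congr MkEll2; exact: Prop_irrelevance.
Qed.

Definition ell2_zero := MkEll2 summable0.
Definition ell2_add (u v : ell2 R) :=
  MkEll2 (summableD (ell2_summableP u) (ell2_summableP v)).
Definition ell2_basis j := MkEll2 (@summable_delta j).
Definition ell2_opp (u : ell2 R) := MkEll2 (summableN (ell2_summableP u)).
Definition ell2_scale f (u : ell2 R) := MkEll2 (@summableZ f _ (ell2_summableP u)).

Let addA : associative ell2_add. Proof. by move=> u v w; apply/ell2_eqP => i; exact: addrA. Qed.
Let addC : commutative ell2_add. Proof. by move=> u v; apply/ell2_eqP => i; exact: addrC. Qed.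
Let add0 : left_id ell2_zero ell2_add. Proof. by move=> u; apply/ell2_eqP => i; exact: add0r. Qed.
Let addN : left_inverse ell2_zero ell2_opp ell2_add. Proof. by move=> u; apply/ell2_eqP => i; exact: addNr. Qed.
HB.instance Definition _ := GRing.isZmodule.Build (ell2 R) addA addC add0 addN.

Let scaleA a b u : ell2_scale a (ell2_scale b u) = ell2_scale (a * b) u.
Proof. by apply/ell2_eqP => i; exact: mulrA. Qed.
Let scale1 : left_id 1 ell2_scale. Proof. by move=> u; apply/ell2_eqP => i; exact: mul1r. Qed.
Let scaleDr : right_distributive ell2_scale +%R. Proof. by move=> a u v; apply/ell2_eqP => i; exact: mulrDr. Qed.
Let scaleDl u : {morph ell2_scale^~ u : a b / a + b}. Proof. by move=> a b; apply/ell2_eqP => i; exact: mulrDl. Qed.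
HB.instance Definition _ := GRing.Zmodule_isLmodule.Build (C01 R) (ell2 R) scaleA scale1 scaleDr scaleDl.

Definition inner (u v : ell2 R) : C01 R := limn (series (fun i => u i * C01_star (v i))).

Definition ell2_norm (u : ell2 R) : R := Num.sqrt `|inner u u|.

Let inner_cvg (u : ell2 R) : (fun n => `|tail u 0 n|) @ \oo --> `|inner u u|.
Proof. by apply: cvg_norm; exact: ell2_summableP. Qed.

Let N_ge (u : ell2 R) n : `|tail u 0 n| <= `|inner u u|.
Proof.
rewrite -(cvg_lim _ (@inner_cvg u))//.
apply: nondecreasing_cvgn_le; last by apply/cvg_ex; exists `|inner u u|; exact: inner_cvg.
move=> p q pq; apply: C01_norm_le => t; rewrite tail_normE.
apply: le_trans (@tail_norm u 0 q t).
by rewrite (big_cat_nat _ pq)//= lerDl sumr_ge0.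
Qed.

Let ND (s : R) (u v : ell2 R) : 0 < s ->
  `|inner (u + v) (u + v)| <= (1 + s) * `|inner u u| + (1 + s^-1) * `|inner v v|.
Proof.
move=> s0; apply: (ler_cvg_to (@inner_cvg (u + v))).
  by apply: cvgD; apply: cvgMr; exact: inner_cvg.
by apply: nearW => n; exact: tailD.
Qed.

Let NZ f (u : ell2 R) : `|inner (f *: u) (f *: u)| <= `|f| ^+ 2 * `|inner u u|.
Proof.
apply: (ler_cvg_to (@inner_cvg (f *: u))); first by apply: cvgMr; exact: inner_cvg.
by apply: nearW => n; exact: tailZ.
Qed.

Let norm0 (u : ell2 R) : ell2_norm u = 0 -> u = 0.
Proof.
move/eqP; rewrite sqrtr_eq0 => u0; apply/ell2_eqP => i; apply/C01_eqP => t.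
apply: eq0_normc; apply/eqP; rewrite -sqrf_eq0 eq_le sqr_ge0 andbT.
apply: le_trans u0; apply: le_trans (N_ge u i.+1); apply: le_trans (@tail_norm u 0 i.+1 t).
by rewrite big_nat_recr//= lerDr sumr_ge0.
Qed.

Let norm_ge0 u : 0 <= ell2_norm u. Proof. exact: sqrtr_ge0. Qed.
Let norm_sq u : `|inner u u| = ell2_norm u ^+ 2. Proof. by rewrite sqr_sqrtr. Qed.

Let normD (u v : ell2 R) : ell2_norm (u + v) <= ell2_norm u + ell2_norm v.
Proof.
have [u0|u0] := eqVneq (ell2_norm u) 0; first by rewrite (norm0 u0) add0r lerDr.
have [v0|v0] := eqVneq (ell2_norm v) 0; first by rewrite (norm0 v0) addr0 lerDl.
have up : 0 < ell2_norm u by rewrite lt_def u0 norm_ge0.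
have vp : 0 < ell2_norm v by rewrite lt_def v0 norm_ge0.
rewrite -ler_sqr ?nnegrE ?addr_ge0// -norm_sq.
apply: le_trans (@ND (ell2_norm v / ell2_norm u) u v _) _; first by rewrite divr_gt0.
rewrite !norm_sq le_eqVlt; apply/orP; left; apply/eqP.
by field; rewrite u0 v0.
Qed.

Lemma ell2_normZ_le f (u : ell2 R) : ell2_norm (f *: u) <= `|f| * ell2_norm u.
Proof.
rewrite -ler_sqr ?nnegrE ?mulr_ge0// exprMn -!norm_sq; exact: NZ.
Qed.

Lemma ell2_natE (u : ell2 R) n i : (u *+ n) i = u i *+ n.
Proof. by elim: n => // n IH; rewrite !mulrS -IH. Qed.

Lemma C01_norm_cst (c : Cx R) : `|C01_cst c| = normc c.
Proof.
apply/eqP; rewrite eq_le; apply/andP; split; first by apply: C01_norm_le.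
exact: (C01_norm_ge (C01_cst c) (I01_zero R)).
Qed.

Let normMn (u : ell2 R) n : ell2_norm (u *+ n) = ell2_norm u *+ n.
Proof.
have z0 : ell2_norm 0 = 0.
  by apply/eqP; rewrite eq_le norm_ge0 andbT -(scale0r 0); apply: le_trans (ell2_normZ_le _ _) _; rewrite normr0 mul0r.
case: n => [|n]; first by rewrite !mulr0n.
apply/eqP; rewrite eq_le; apply/andP; split.
  elim: n => // n IH; rewrite (mulrS (ell2_norm u) n.+1) (mulrS u n.+1).
  by apply: le_trans (normD _ _) _; rewrite lerD2l.
pose c := C01_cst (n.+1%:R^-1 : Cx R).
have uE : u = c *: (u *+ n.+1).
  apply/ell2_eqP => i; apply/C01_eqP => t; rewrite /= ell2_natE C01_natE.
  by rewrite -[u i t *+ _]mulr_natl mulrA mulVf ?mul1r// pnatr_eq0.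
rewrite {1}uE; apply: (@le_trans _ _ ((`|c| * ell2_norm (u *+ n.+1)) *+ n.+1)).
  by rewrite lerMn2r ell2_normZ_le orbT.
rewrite -mulr_natl mulrA ler_piMl// C01_norm_cst normcV.
by rewrite -(rmorph_nat (real_complex R)) normc_real ger0_norm// mulfV// pnatr_eq0.
Qed.

Let normN (u : ell2 R) : ell2_norm (- u) = ell2_norm u.
Proof.
have le v : ell2_norm (- v) <= ell2_norm v.
  by rewrite -scaleN1r; apply: le_trans (ell2_normZ_le _ _) _; rewrite normrN C01_norm_cst normc1 mul1r.
by apply/eqP; rewrite eq_le le -{1}(opprK u) le.
Qed.

HB.instance Definition _ := Num.Zmodule_isNormed.Build R (ell2 R) normD norm0 normMn normN.
HB.instance Definition _ := PseudoMetric.copy (ell2 R) (pseudoMetric_normed (ell2 R)).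
HB.instance Definition _ := isPointed.Build (ell2 R) 0.
HB.instance Definition _ := NormedZmod_PseudoMetric_eq.Build R (ell2 R) erefl.
End ell2_mod.

Section hilbert.
Variable R : realType.
Local Notation A := (C01 R).
Local Notation N := (ell2 R).
Implicit Types (M : set N) (r : N -> A).

Definition closed_submodule M : Prop :=
  [/\ M 0, (forall (a : A) x y, M x -> M y -> M (a *: x + y)) & closed M].

Definition orth_compl M : set N := [set n | forall m, M m -> inner n m = 0].

(* The complex linear span of the inner products of elements of M. *)
Definition inner_span M : set A :=
  [set f | exists (n : nat) (c : 'I_n -> Cx R) (x y : 'I_n -> N),
    (forall i, M (x i) /\ M (y i)) /\ f = \sum_i c i *: inner (x i) (y i)].

Definition full_submodule M : Prop := closure (inner_span M) = setT.

Definition bounded_functional r : Prop :=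
  scalar r /\ exists k : R, forall n, `|r n| <= k * `|n|.

Definition dual_scale (a : A) r : N -> A := fun n => r n * C01_star a.

Definition dual_embed (x : N) : N -> A := fun n => inner n x.

Definition nondegenerate_functional r : Prop :=
  forall a : A, dual_scale a r = cst 0 <-> a = 0.

Definition functional_ker r : set N := [set n | r n = 0].

Definition biorthogonally_complemented M : Prop := M = orth_compl (orth_compl M).

Definition bounded_operator (U : N -> N) : Prop :=
  linear U /\ exists k : R, forall n, `|U n| <= k * `|n|.

Definition adjoint_pair (U V : N -> N) : Prop :=
  [/\ bounded_operator U, bounded_operator V
    & forall x y, inner (U x) y = inner x (V y)].

(* A unitary is an adjointable operator whose adjoint V is its inverse. *)
Definition unitary_pair (U V : N -> N) : Prop :=
  [/\ adjoint_pair U V, cancel U V & cancel V U].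

Definition unitarily_isomorphic M1 r1 M2 r2 : Prop :=
  exists U V, [/\ unitary_pair U V, U @` M1 = M2 & r2 = r1 \o V].
End hilbert.

Section ks.
Variable R : realType.

(* The breakpoints q j / (j + 1). *)
Definition ks_node (q : R) (j : nat) : R := j%:R * q / j.+1%:R.

(* The square of the function psi_{q, m + 1} (m is zero-based): the hat function
   with value 1 at ks_node q m that vanishes outside ] ks_node q (m - 1),
   ks_node q (m + 1) [ ; for m = 0 there is no rising part, as ks_node q 0 = 0. *)
Definition ks_psi_sq (q : R) (m : nat) (t : R) : R :=
  let b := ks_node q m in
  let fall := (ks_node q m.+1 - t) / (ks_node q m.+1 - b) in
  if m is m'.+1 then
    let rise := (t - ks_node q m') / (b - ks_node q m') in
    Num.max 0 (Num.min rise fall)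
  else Num.max 0 fall.

Lemma ks_psi_sq_continuous q m : continuous (ks_psi_sq q m).
Proof.
have max0 (f : R -> R) t : {for t, continuous f} -> {for t, continuous (fun s => Num.max 0 (f s))}.
  by move=> cf; apply: (@continuous_max R R (cst 0) f) => //; exact: cst_continuous.
have fallc (a b t : R) : {for t, continuous (fun s => (a - s) / b)}.
  apply: (@continuousM R R (fun s => a - s) (cst b^-1)); last exact: cst_continuous.
  by apply: (@continuousB R R R (cst a) id); [exact: cst_continuous|exact: (@cvg_id _ (nbhs t))].
have risec (a b t : R) : {for t, continuous (fun s => (s - a) / b)}.
  apply: (@continuousM R R (fun s => s - a) (cst b^-1)); last exact: cst_continuous.
  by apply: (@continuousB R R R id (cst a)); [exact: (@cvg_id _ (nbhs t))|exact: cst_continuous].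
move=> t; case: m => [|m].
  exact: (max0 (fun s => (ks_node q 1 - s) / (ks_node q 1 - ks_node q 0)) t (fallc _ _ _)).
have := @continuous_min R R (fun s => (s - ks_node q m) / (ks_node q m.+1 - ks_node q m))
  (fun s => (ks_node q m.+2 - s) / (ks_node q m.+2 - ks_node q m.+1)) t (risec _ _ _) (fallc _ _ _).
exact: max0.
Qed.

Lemma ks_psi_continuous q m :
  continuous (fun t : I01 R => (Num.sqrt (ks_psi_sq q m (set_val t)))%:C : Cx R).
Proof.
move=> t.
have c1 : {for t, continuous (fun s : I01 R => ks_psi_sq q m (set_val s))}.
  apply: (@continuous_comp _ _ _ (set_val : I01 R -> R) (ks_psi_sq q m)).
    exact: initial_continuous.
  exact: ks_psi_sq_continuous.
have c2 := @continuous_comp _ _ _ _ (@Num.sqrt R) t c1 (@sqrt_continuous R _).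
exact: (@continuous_comp _ _ _ _ (fun x : R => x%:C : Cx R) t c2 (@real_complex_continuous R _)).
Qed.

Definition ks_psi (q : R) (m : nat) : C01 R := MkC01 (@ks_psi_continuous q m).

(* idx numbers the standard basis of ell2: idx None is the position of e_(0) and
   idx (Some (k, l)) that of e_(k+1),l+1; q k is the (k+1)-th point of Q. It is
   meant to be bijective. *)
Variables (idx : option (nat * nat) -> nat) (q : nat -> R).

Definition ks_generators : set (ell2 R) :=
  [set x | exists k l, x =
    (2 ^- k.+1 *: ks_psi (q k) l) *: ell2_basis R (idx None)
      - ell2_basis R (idx (Some (k, l)))].

Definition ks_module : set (ell2 R) := smallest (@closed_submodule R) ks_generators.

Definition ks_functional (x : ell2 R) : C01 R :=
  x (idx None) +
  limn (series (fun k => (2 ^- k.+1 : Cx R) *: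
    limn (series (fun l => x (idx (Some (k, l))) * C01_star (ks_psi (q k) l))))).

Definition ks_enumeration : Prop :=
  [/\ injective q, forall k, 0 < q k < 1
    & `[0, 1]%classic `<=` closure (range q)].
End ks.

(* Main.v *)
(* In the fibre over t the functional r_Q is represented by the vector with
   entries 1 and 2^-(k+1) psi_{q_k,l}(t), whose squared norm is
   1 + sum_k 4^-(k+1) [t < q_k]. This function of t is invariant under unitary
   isomorphism of pairs, and its jump of height 4^-(k+1) at q_k recovers the
   enumeration q. The representing vector is not a continuous section: if x is
   orthogonal to M_Q then x_{k,l} = 2^-(k+1) psi_{q_k,l} x_0, and since
   psi_{q_k,l} = 1 at points tending to q_k while the x_{k,l} tend to 0 in norm,
   x_0 vanishes at every q_k, hence x = 0. The pairs are indexed by a real number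
   a through the first point of Q, the other points being the remaining rational
   numbers of ]0, 1[. *)
Require Import Defs.
From mathcomp Require Import all_boot all_order all_algebra.
From mathcomp Require Import all_classical all_reals all_analysis.
From mathcomp Require Import complex ring lra.
Import Order.TTheory GRing.Theory Num.Theory numFieldNormedType.Exports.
Import Normc.
Local Open Scope classical_set_scope.
Local Open Scope ring_scope.
Local Open Scope complex_scope.
Set Implicit Arguments. Unset Strict Implicit. Unset Printing Implicit Defensive.

(** * Fibrewise calculus in C([0,1]) and in the standard module: limits, Bessel, Cauchy-Schwarz *)

Section pointwise.
Variable R : realType.
Implicit Types (x y : ell2 R) (u : nat -> C01 R) (t : I01 R).

Lemma C01_lim_at u t : cvgn u -> (fun n => u n t) @ \oo --> (limn u : C01 R) t.
Proof.
move=> cu; apply/cvgCP => e e0.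
move/cvgrPdist_lt: cu => /(_ e e0); apply: filterS => n; apply: le_lt_trans.
exact: (C01_norm_ge (limn u - u n)).
Qed.

(** The index [N] is the same for every [t], so the pointwise estimates bound the sup norm of the
    tails, and completeness applies. *)
Lemma C01_series_cvg u :
  (forall e : R, 0 < e -> exists N, forall n t, (N <= n)%N ->
     normc (\sum_(N <= i < n) u i t) <= e) ->
  cvgn (series u).
Proof.
move=> h; apply: cauchy_cvg; apply: cauchy_exP => e e0.
have [|N NP] := h (e / 2); first by rewrite divr_gt0.
exists (series u N), N => // n /= Nn; rewrite -ball_normE /ball_ /= distrC.
have -> : series u n - series u N = \sum_(N <= i < n) u i.
  by rewrite /series/= (big_cat_nat _ Nn)//= addrAC subrr add0r.
apply: (@le_lt_trans _ _ (e / 2)); last by rewrite ltr_pdivrMr// ltr_pMr// ltr1n.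
by apply: C01_norm_le => t; rewrite C01_sumE; exact: NP.
Qed.

(** The numbering [idx] scatters a block over the basis in arbitrary order. Since the terms are
    nonnegative, such a finite family is dominated by a full interval of indices. *)
Lemma big_uniq_le (a : nat -> R) (s : seq nat) N : (forall i, 0 <= a i) ->
  uniq s -> all (leq N) s ->
  exists2 M, (N <= M)%N & \sum_(i <- s) a i <= \sum_(N <= i < M) a i.
Proof.
move=> a0 us /allP Ns; exists (maxn N (\max_(i <- s) i).+1); first exact: leq_maxl.
set r := index_iota N _.
have sr : perm_eq s [seq i <- r | i \in s].
  apply: uniq_perm => //; first by rewrite filter_uniq// iota_uniq.
  move=> i; rewrite mem_filter mem_index_iota; case: (boolP (i \in s)) => //= si.
  by rewrite Ns//= leq_max ltnS leq_bigmax_seq// orbT.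
rewrite (perm_big _ sr)/= big_filter big_mkcond/=; apply: ler_sum => i _.
by case: ifP.
Qed.

Lemma inner_series_at x t n :
  series (fun i => x i * C01_star (x i)) n t = (\sum_(i < n) normc (x i t) ^+ 2)%:C.
Proof.
rewrite /series/= C01_sumE big_mkord rmorph_sum; apply: eq_bigr => i _; exact: mul_conjc.
Qed.

Lemma inner_cvg_at x t :
  (fun n => \sum_(i < n) normc (x i t) ^+ 2) @ \oo --> normc (inner x x t).
Proof.
have h := @C01_lim_at _ t (ell2_summableP x).
have -> : (fun n => \sum_(i < n) normc (x i t) ^+ 2) =
    (fun n => normc (series (fun i => x i * C01_star (x i)) n t)).
  apply/funext => n /=; rewrite inner_series_at normc_real ger0_norm// sumr_ge0// => i _.
  exact: sqr_ge0.
exact: (@cvg_comp _ _ _ _ (fun z : Cx R => normc z : R) _ _ _ h (@normc_continuous R _)).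
Qed.

Lemma inner_self_ge x t (s : seq nat) : uniq s ->
  \sum_(i <- s) normc (x i t) ^+ 2 <= normc (inner x x t).
Proof.
move=> us.
have [||M _ le] := @big_uniq_le (fun i => normc (x i t) ^+ 2) s 0 _ us.
- by move=> i; exact: sqr_ge0.
- exact/allP.
apply: le_trans le _; rewrite big_mkord.
have nd : nondecreasing_seq (fun n => \sum_(i < n) normc (x i t) ^+ 2).
  by apply/nondecreasing_seqP => n; rewrite big_ord_recr/= lerDl sqr_ge0.
have := nondecreasing_cvgn_le nd (cvgP _ (@inner_cvg_at x t)) M.
by rewrite (cvg_lim _ (@inner_cvg_at x t)).
Qed.

Lemma inner_self_le x t : normc (inner x x t) <= `|x| ^+ 2.
Proof.
rewrite sqr_sqrtr; last exact: normr_ge0.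
exact: C01_norm_ge.
Qed.

(** Summability holds in norm, so [N] does not depend on [t]. This uniformity later makes the block
    sums converge in norm and forces vectors orthogonal to the generators to vanish. *)
Lemma ell2_tail x (e : R) : 0 < e -> exists N, forall s t, uniq s -> all (leq N) s ->
  \sum_(i <- s) normc (x i t) ^+ 2 <= e.
Proof.
move=> e0; have /cvg_ex[l /cvgrPdist_lt cl] := ell2_summableP x.
have [|N _ NP] := cl (e / 2); first by rewrite divr_gt0.
exists N => s t us Ns.
have [|M NM le] := @big_uniq_le (fun i => normc (x i t) ^+ 2) s N _ us Ns.
  by move=> i; exact: sqr_ge0.
apply: le_trans le _; set S := series _ in NP.
have E : ((\sum_(N <= i < M) normc (x i t) ^+ 2)%:C : Cx R) = (S M - S N) t.
  rewrite /= !inner_series_at -rmorphB -!(big_mkord xpredT (fun i => normc (x i t) ^+ 2)).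
  by rewrite (big_cat_nat (m := 0) _ NM)//= addrAC subrr add0r.
apply: (@le_trans _ _ (normc ((S M - S N) t))).
  by rewrite -E normc_real ler_norm.
apply: le_trans (C01_norm_ge _ _) _; rewrite -[C01_norm _]/(`|S M - S N|).
have -> : S M - S N = (l - S N) - (l - S M) by ring.
apply: le_trans (ler_normB _ _) _.
by rewrite [leRHS]splitr lerD// ltW//; apply: NP => /=.
Qed.

Lemma CauchySchwarz_sum (I : Type) (s : seq I) (a b : I -> R) :
  (\sum_(i <- s) a i * b i) ^+ 2 <= (\sum_(i <- s) a i ^+ 2) * (\sum_(i <- s) b i ^+ 2).
Proof.
set S := \sum_(i <- s) a i * b i; set A := \sum_(i <- s) a i ^+ 2.
set B := \sum_(i <- s) b i ^+ 2.
have E c d : \sum_(i <- s) (c * a i - d * b i) ^+ 2 = c ^+ 2 * A - 2 * c * d * S + d ^+ 2 * B.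
  rewrite /A /B /S !mulr_sumr -sumrB -big_split/=; apply: eq_bigr => i _; ring.
have B0 : 0 <= B by apply: sumr_ge0 => i _; exact: sqr_ge0.
have A0 : 0 <= A by apply: sumr_ge0 => i _; exact: sqr_ge0.
have P c d : 0 <= c ^+ 2 * A - 2 * c * d * S + d ^+ 2 * B.
  by rewrite -E; apply: sumr_ge0 => i _; exact: sqr_ge0.
(* The form at [(B, S)] equals [B * (A * B - S ^+ 2)], which suffices when [B] is positive. If [B]
   is 0, its value at [(S, A + 1)] is [- S ^+ 2 * (A + 2)], which forces [S] to be 0. *)
have := P B S; have := P S (A + 1).
move: B0; rewrite le_eqVlt => /orP[/eqP <-|B0]; first nra.
move=> _ h; rewrite -(ler_pM2l B0); nra.
Qed.

Lemma normc_CauchySchwarz (I : Type) (s : seq I) (a : I -> Cx R) (b : I -> R) :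
  normc (\sum_(i <- s) a i * (b i)%:C) ^+ 2 <=
  (\sum_(i <- s) normc (a i) ^+ 2) * (\sum_(i <- s) b i ^+ 2).
Proof.
have -> : \sum_(i <- s) b i ^+ 2 = \sum_(i <- s) `|b i| ^+ 2.
  by apply: eq_bigr => i _; rewrite real_normK ?num_real.
apply: le_trans (@CauchySchwarz_sum _ s (fun i => normc (a i)) (fun i => `|b i|)).
have S0 : 0 <= \sum_(i <- s) normc (a i) * `|b i|.
  by apply: sumr_ge0 => i _; rewrite mulr_ge0// normc_ge0.
rewrite lerXn2r ?nnegrE ?normc_ge0//.
elim/big_rec2: _ => [|i y z _ h]; first by rewrite normc0.
by apply: le_trans (le_normcD _ _) _; rewrite lerD// normcM normc_real.
Qed.

Lemma I01_near (f : C01 R) t (e : R) : 0 < e ->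
  exists2 d, 0 < d & forall s, `|set_val t - set_val s| < d -> normc (f t - f s) < e.
Proof.
move=> e0; have := (@cvgCP _ _ (nbhs t) (nbhs_filter t) _ _).1 (@C01_continuous R f t) e e0.
rewrite nbhsE => -[B' [[C oC <-] /= Ct] CB].
have : nbhs (set_val t) C by exact: open_nbhs_nbhs.
move=> /nbhs_ballP[d /= d0 dC]; exists d => // s ts; apply: CB => /=.
by apply: dC; rewrite -ball_normE.
Qed.

Lemma cvg_normc_sq (u : nat -> Cx R) (l : Cx R) : u @ \oo --> l ->
  (fun n => normc (u n) ^+ 2 : R) @ \oo --> (normc l ^+ 2 : R).
Proof.
move=> h; have {}h : (fun n => normc (u n) : R) @ \oo --> (normc l : R).
  exact: (@cvg_comp _ _ _ _ (fun z : Cx R => normc z : R) _ _ _ h (@normc_continuous R _)).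
exact: (cvgM h h).
Qed.

(** Reduces linearity of the functional to identities between partial sums. *)
Lemma Cx_cvg_unique (u v : nat -> Cx R) (l l' : Cx R) :
  u @ \oo --> l -> v @ \oo --> l' -> u =1 v -> l = l'.
Proof.
move=> ul vl /funext uv; rewrite uv in ul.
have H : hausdorff_space (Cx R) by exact: (@norm_hausdorff _ (Cx R)).
exact: (cvg_unique H ul vl).
Qed.

Lemma lim_series_finite (u : nat -> C01 R) n : (forall i, (n <= i)%N -> u i = 0) ->
  limn (series u) = \sum_(i < n) u i.
Proof.
move=> un; apply: lim_near_cst; first exact: (@norm_hausdorff _ (C01 R)).
exists n => // m /= nm; rewrite /series/= (big_cat_nat _ nm)//= big_mkord.
rewrite [X in _ + X]big_nat_cond [X in _ + X]big1 ?addr0// => i /andP[/andP[ni _] _].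
exact: un.
Qed.

Lemma lim_series_pair (u : nat -> C01 R) i j : i != j ->
  (forall k, k != i -> k != j -> u k = 0) -> limn (series u) = u i + u j.
Proof.
move=> ij uk.
have iN : (i < (maxn i j).+1)%N by rewrite ltnS leq_maxl.
have jN : (j < (maxn i j).+1)%N by rewrite ltnS leq_maxr.
rewrite (@lim_series_finite _ (maxn i j).+1) => [|k].
  rewrite (bigD1 (Ordinal iN))//= (bigD1 (Ordinal jN))/=; last by rewrite -val_eqE/= eq_sym.
  rewrite big1 ?addr0// => k /andP[ki kj]; exact: uk.
by rewrite gtn_max => /andP[ik jk]; apply: uk; rewrite gtn_eqF.
Qed.

Lemma lim_series_delta (u : nat -> C01 R) j : (forall i, i != j -> u i = 0) ->
  limn (series u) = u j.
Proof.
move=> uj; apply: lim_near_cst; first exact: (@norm_hausdorff _ (C01 R)).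
exists j.+1 => // n /= jn; rewrite /series/= big_mkord (bigD1 (Ordinal jn))//=.
by rewrite big1 ?addr0// => i ij; apply: uj.
Qed.

Lemma C01_star_at (f : C01 R) t : C01_star f t = conjc (f t).
Proof. by []. Qed.

Lemma C01_starB (f g : C01 R) : C01_star (f - g) = C01_star f - C01_star g.
Proof. by apply/C01_eqP => t; rewrite /= -rmorphB. Qed.

Lemma C01_starM (f g : C01 R) : C01_star (f * g) = C01_star f * C01_star g.
Proof. by apply/C01_eqP => t; rewrite /= -rmorphM. Qed.

Lemma C01_starK (f : C01 R) : C01_star (C01_star f) = f.
Proof. by apply/C01_eqP => t; rewrite /= conjcK. Qed.

Lemma C01_star0 : C01_star 0 = 0 :> C01 R.
Proof. by apply/C01_eqP => t; exact: (rmorph0 (@conjc R)). Qed.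

Lemma C01_star1 : C01_star 1 = 1 :> C01 R.
Proof. by apply/C01_eqP => t; exact: (rmorph1 (@conjc R)). Qed.

Lemma C01_inv (f : C01 R) : (forall t, f t != 0) -> exists g : C01 R, g * f = 1.
Proof.
move=> f0.
have cg : continuous (fun t => (f t)^-1).
  by move=> t; apply: (@cvgV (Cx R) _ _ (nbhs_filter t)) => //; exact: (@C01_continuous R f t).
by exists (MkC01 cg); apply/C01_eqP => t /=; rewrite mulVf.
Qed.

Lemma ell2_basisE i j : ell2_basis R i j = (j == i)%:R.
Proof. by rewrite /=; case: eqP. Qed.

Lemma inner0l y : inner 0 y = 0.
Proof.
rewrite /inner (@lim_series_finite _ 0) ?big_ord0// => i _; exact: mul0r.
Qed.

Lemma inner0r x : inner x 0 = 0.
Proof.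
by rewrite /inner (@lim_series_finite _ 0) ?big_ord0// => i _; rewrite C01_star0 mulr0.
Qed.

Lemma ell2_sum_coord (a : nat -> C01 R) n j :
  (\sum_(0 <= i < n) a i *: ell2_basis R i) j = if (j < n)%N then a j else 0.
Proof.
elim: n => [|n IH]; first by rewrite big_geq.
rewrite big_nat_recr//; set S := bigop _ _ _ in IH *.
rewrite -[LHS]/(S j + a n * ell2_basis R n j) IH ell2_basisE ltnS; case: (ltngtP j n) => [||->].
- by rewrite mulr0 addr0.
- by rewrite mulr0 addr0.
- by rewrite mulr1 add0r.
Qed.

End pointwise.

(** * The hat functions as a partition of unity on [0, q) *)

Section hat_functions.
Variable R : realType.
Implicit Types (q t : R).

(** In this form the nodes visibly increase to [q]. *)
Lemma ks_nodeE q j : ks_node q j = q - q / j.+1%:R.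
Proof. by rewrite /ks_node -natr1; field; rewrite natr1 pnatr_eq0. Qed.

Lemma ks_node_lt q j : 0 < q -> ks_node q j < ks_node q j.+1.
Proof.
move=> q0; rewrite !ks_nodeE ltrD2l ltrN2 ltr_pM2l// ltf_pV2 ?posrE ?ltr0n//.
by rewrite ltr_nat.
Qed.

Lemma ks_node_lt_q q j : 0 < q -> ks_node q j < q.
Proof. by move=> q0; rewrite ks_nodeE ltrBlDr ltrDl divr_gt0// ltr0n. Qed.

Lemma ks_node_ge0 q j : 0 < q -> 0 <= ks_node q j.
Proof. by move=> q0; rewrite /ks_node divr_ge0// mulr_ge0// ltW. Qed.

Lemma ks_node_near q (e : R) : 0 < q -> 0 < e ->
  exists J, forall j, (J <= j)%N -> q - ks_node q j < e.
Proof.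
move=> q0 e0; exists (Num.truncn (q / e)) => j Jj.
rewrite ks_nodeE opprB addrCA subrr addr0 ltr_pdivrMr ?ltr0n// mulrC -ltr_pdivrMr//.
apply: (lt_le_trans (truncnS_gt _)); by rewrite ler_nat ltnS.
Qed.

Lemma ks_psi_sq_ge0 q m t : 0 <= ks_psi_sq q m t.
Proof. by case: m => [|m]; rewrite /ks_psi_sq le_max lexx. Qed.

Lemma ks_psi_sq_node q m : 0 < q -> ks_psi_sq q m (ks_node q m) = 1.
Proof.
move=> q0.
have d0 j : ks_node q j.+1 - ks_node q j != 0 by rewrite subr_eq0 gt_eqF// ks_node_lt.
case: m => [|m]; rewrite /ks_psi_sq.
  by rewrite divff// max_r.
by rewrite !divff// minxx max_r.
Qed.

(* Consecutive edges add up to 1, so only the last falling edge survives. *)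
Lemma ks_psi_sq_sum q t m : 0 < q -> 0 <= t ->
  \sum_(i < m.+1) ks_psi_sq q i t =
  Num.max 0 (Num.min 1 ((ks_node q m.+1 - t) / (ks_node q m.+1 - ks_node q m))).
Proof.
move=> q0 t0; elim: m => [|m IH].
  rewrite big_ord1 /ks_psi_sq; congr Num.max; rewrite min_r//.
  have n00 : ks_node q 0 = 0 by rewrite /ks_node !mul0r.
  have := @ks_node_lt q 0 q0; rewrite n00 => n1.
  by rewrite subr0 ler_pdivrMr// mul1r gerBl.
rewrite big_ord_recr/= {}IH.
have ab := @ks_node_lt q m q0; have bc := @ks_node_lt q m.+1 q0.
set a := ks_node q m in ab *; set b := ks_node q m.+1 in ab bc *.
set c := ks_node q m.+2 in bc *.
have -> : (t - a) / (b - a) = 1 - (b - t) / (b - a) by field; lra.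
set u := (b - t) / (b - a); set v := (c - t) / (c - b).
have u0 : (0 <= u) = (t <= b) by rewrite pmulr_lge0 ?invr_gt0 ?subr_gt0// subr_ge0.
have v1 : (1 <= v) = (t <= b).
  by rewrite ler_pdivlMr ?subr_gt0// mul1r lerD2l lerN2.
(* The split is at the peak [b] of the new hat. To its left the new rising edge [1 - u] complements
   the previous sum to 1; to its right the previous sum is 0 and only the falling edge [v] is
   left. *)
case: (leP t b) u0 v1 => _ u0 v1.
  have -> : Num.min (1 - u) v = 1 - u by apply: min_l; lra.
  have -> : Num.min 1 v = 1 by apply: min_l.
  rewrite (max_r ler01); case: (leP 1 u) => u1.
    have -> : Num.max 0 (1 - u) = 0 by apply: max_l; lra.
    by rewrite (max_r ler01) addr0.
  by rewrite !max_r//; lra.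
have {}u0 : u < 0 by rewrite ltNge u0.
have {}v1 : v < 1 by rewrite ltNge v1.
have -> : Num.min (1 - u) v = v by apply: min_r; lra.
have -> : Num.min 1 u = u by apply: min_r; lra.
have -> : Num.min 1 v = v by apply: min_r; lra.
by rewrite (max_l (ltW u0)) add0r.
Qed.

Lemma ks_psi_sq_sum_le q t m : 0 < q -> 0 <= t ->
  \sum_(i < m) ks_psi_sq q i t <= (t < q)%R%:R.
Proof.
move=> q0 t0; case: m => [|m]; first by rewrite big_ord0.
rewrite ks_psi_sq_sum// ge_max ler0n/= ge_min; case: ltP => /= qt; first by rewrite lexx.
rewrite orbC pmulr_lle0 ?invr_gt0 ?subr_gt0 ?ks_node_lt// subr_le0.
by rewrite (le_trans _ qt)// ltW// ks_node_lt_q.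
Qed.

Lemma ks_psi_sq_sum_eq q t : 0 < q -> 0 <= t ->
  exists m, \sum_(i < m) ks_psi_sq q i t = (t < q)%R%:R.
Proof.
move=> q0 t0; case: ltP => tq; last by exists 0%N; rewrite big_ord0.
have [|J /(_ _ (leqnn J)) h] := @ks_node_near q (q - t) q0; first by rewrite subr_gt0.
exists J.+1; rewrite ks_psi_sq_sum// min_l ?max_r//.
have bc := @ks_node_lt q J q0.
by rewrite ler_pdivlMr ?subr_gt0// mul1r lerD2l lerN2; lra.
Qed.

Lemma I01_bounds (t : I01 R) : 0 <= set_val t <= 1.
Proof. by have := set_valP t; rewrite /= in_itv. Qed.

Lemma I01_mk (s : R) : 0 <= s <= 1 -> exists t : I01 R, set_val t = s.
Proof.
move=> s01; have sm : s \in `[0, 1]%classic by rewrite inE/= in_itv.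
by exists (exist _ s sm).
Qed.

Lemma ks_psi_star q m : C01_star (ks_psi q m) = ks_psi q m.
Proof. by apply/C01_eqP => t /=; rewrite oppr0. Qed.

End hat_functions.

(** * The functional r_Q: convergence, fibrewise norm bound, linearity, values on the basis *)

Section functional.
Variables (R : realType) (idx : option (nat * nat) -> nat) (idx_bij : bijective idx).
Implicit Types (x y : ell2 R) (t : I01 R) (q : nat -> R).

(** Only finitely many positions lie below [N], so a tail of one block lies in a tail of the whole
    basis. *)
Lemma idx_tail k N : exists m, forall l, (m <= l)%N -> (N <= idx (Some (k, l)))%N.
Proof.
have [g gK Kg] := idx_bij.
(* The default 0 at the position of [None] cannot spoil the maximum below, which bounds the second
   coordinate of every pair numbered before [N]. *)
pose snd_of i := if g i is Some (_, l) then l else 0%N.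
exists (\max_(i < N) snd_of i).+1 => l; apply: contraTT; rewrite -!ltnNge => lN.
by have := @leq_bigmax_cond _ xpredT (snd_of \o val) (Ordinal lN); rewrite /= /snd_of gK; exact.
Qed.

Definition ks_coef q x k : C01 R :=
  limn (series (fun l => x (idx (Some (k, l))) * C01_star (ks_psi (q k) l))).

Definition ks_weight k : R := 2 ^- k.+1.

Lemma ks_weightE k : (2 ^- k.+1 : Cx R) = (ks_weight k)%:C.
Proof. by rewrite /ks_weight fmorphV rmorphXn/= rmorph_nat. Qed.

Lemma ks_weight_ge0 k : 0 <= ks_weight k.
Proof. by rewrite invr_ge0 exprn_ge0. Qed.

(* Squared norm, in the fibre over t, of the functional truncated after K blocks. *)
Definition ks_profile q K t : R :=
  1 + \sum_(0 <= k < K) ks_weight k ^+ 2 * (set_val t < q k)%R%:R.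

(* The geometric tail sum_(k >= K) 4^-(k+1). *)
Definition ks_profile_err K : R := 4 ^- K / 3.

Lemma ks_weight_tail m n : (m <= n)%N ->
  \sum_(m <= k < n) ks_weight k = 2 ^- m - 2 ^- n.
Proof.
move=> mn; rewrite (eq_bigr (fun k => - 2 ^- k.+1 - - 2 ^- k)) => [|k _].
  by rewrite telescope_sumr// opprK addrC.
by rewrite /ks_weight exprS; field; rewrite expf_neq0.
Qed.

Section one_sequence.
Variables (q : nat -> R) (q_gt0 : forall k, 0 < q k).

Let psi k l t : R := Num.sqrt (ks_psi_sq (q k) l (set_val t)).

Let psi_sq k l t : psi k l t ^+ 2 = ks_psi_sq (q k) l (set_val t).
Proof. by rewrite sqr_sqrtr// ks_psi_sq_ge0. Qed.

Let psiE k l t : C01_star (ks_psi (q k) l) t = (psi k l t)%:C.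
Proof. by rewrite ks_psi_star. Qed.

Let psi_sum k L t : \sum_(l < L) psi k l t ^+ 2 <= (set_val t < q k)%R%:R.
Proof.
under eq_bigr do rewrite psi_sq.
by apply: ks_psi_sq_sum_le => //; have /andP[] := I01_bounds t.
Qed.

Let psi_sum1 k m L t : \sum_(m <= l < L) psi k l t ^+ 2 <= 1.
Proof.
apply: (@le_trans _ _ (\sum_(0 <= l < L) psi k l t ^+ 2)); last first.
  by rewrite big_mkord; apply: le_trans (psi_sum _ _ _) _; case: ltP.
have [mL|Lm] := leqP m L; last by rewrite (big_geq (ltnW Lm)) sumr_ge0// => i _; exact: sqr_ge0.
by rewrite (big_cat_nat (m := 0) _ mL)//= lerDr sumr_ge0// => i _; exact: sqr_ge0.
Qed.

(** The squares of the [psi k l t] sum to at most 1, so by Cauchy-Schwarz the tails are controlled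
    by tails of [x], uniformly in [t]. *)
Lemma ks_coef_cvg x k :
  cvgn (series (fun l => x (idx (Some (k, l))) * C01_star (ks_psi (q k) l))).
Proof.
apply: C01_series_cvg => e e0.
have [|N NP] := @ell2_tail R x (e ^+ 2); first by rewrite exprn_gt0.
have [m mP] := idx_tail k N; exists m => n t mn.
rewrite -ler_sqr ?nnegrE ?normc_ge0 ?(ltW e0)//.
rewrite (eq_bigr (fun l => x (idx (Some (k, l))) t * (psi k l t)%:C)) => [|l _]; last first.
  by rewrite -psiE.
apply: le_trans (normc_CauchySchwarz _ _ _) _; rewrite -[leRHS]mulr1.
apply: ler_pM => //.
- by apply: sumr_ge0 => l _; exact: sqr_ge0.
- by apply: sumr_ge0 => l _; exact: sqr_ge0.
rewrite -(big_map (fun l => idx (Some (k, l))) xpredT (fun i => normc (x i t) ^+ 2)).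
apply: NP.
  by rewrite map_inj_uniq ?iota_uniq// => i j /(bij_inj idx_bij)[].
by rewrite all_map; apply/allP => l; rewrite mem_index_iota => /andP[/mP].
Qed.

Lemma ks_coef_at x k t :
  (fun L => \sum_(0 <= l < L) x (idx (Some (k, l))) t * (psi k l t)%:C) @ \oo --> ks_coef q x k t.
Proof.
have -> : (fun L => \sum_(0 <= l < L) x (idx (Some (k, l))) t * (psi k l t)%:C) =
  (fun L => series (fun l => x (idx (Some (k, l))) * C01_star (ks_psi (q k) l)) L t).
  apply/funext => L; rewrite /series/= C01_sumE; apply: eq_bigr => l _.
  by rewrite -psiE.
exact/C01_lim_at/ks_coef_cvg.
Qed.

Let partial x K t : Cx R :=
  x (idx None) t + \sum_(0 <= k < K) (ks_weight k)%:C * ks_coef q x k t.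

(** Cauchy-Schwarz in the fibre over [t] against the vector with entries 1 and
    [ks_weight k * psi k l t]; its squared norm over [K] blocks is at most [ks_profile q K t]. *)
Let partial_bound x K t :
  normc (partial x K t) ^+ 2 <= ks_profile q K t * normc (inner x x t).
Proof.
(* Each block is also cut after [L] entries, which leaves one finite sum over the list [s]; the
   estimate then passes to the limit in [L]. *)
pose f L : Cx R := x (idx None) t +
  \sum_(0 <= k < K) (ks_weight k)%:C * \sum_(0 <= l < L) x (idx (Some (k, l))) t * (psi k l t)%:C.
have cf : f @ \oo --> partial x K t.
  apply: cvgD; first exact: cvg_cst.
  apply: (cvg_big (op := +%R)) => [|k _].
    exact: add_continuous.
  by apply: cvgM; [exact: cvg_cst|exact: ks_coef_at].
apply: (ler_cvg_to (cvg_normc_sq cf) (cvg_cst _)); apply: nearW => L.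
pose a (i : option (nat * nat)) : Cx R := x (idx i) t.
pose b (i : option (nat * nat)) : R := if i is Some (k, l) then ks_weight k * psi k l t else 1.
pose s := None :: [seq Some (k, l) | k <- index_iota 0 K, l <- index_iota 0 L].
have -> : f L = \sum_(i <- s) a i * (b i)%:C.
  rewrite big_cons big_allpairs_dep mulr1; congr (_ + _); apply: eq_bigr => k _.
  rewrite mulr_sumr; apply: eq_bigr => l _.
  by rewrite /a/b rmorphM/=; ring.
apply: le_trans (normc_CauchySchwarz _ _ _) _; rewrite mulrC.
apply: ler_pM; try by apply: sumr_ge0 => i _; exact: sqr_ge0.
  rewrite big_cons big_allpairs_dep expr1n lerD2l; apply: ler_sum => k _.
  rewrite big_mkord /b; under eq_bigr do rewrite exprMn.
  by rewrite -mulr_sumr ler_wpM2l ?sqr_ge0.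
rewrite -(big_map idx xpredT (fun i => normc (x i t) ^+ 2)); apply: inner_self_ge.
rewrite map_inj_uniq; last exact: bij_inj.
rewrite /s/= allpairs_uniq ?iota_uniq//; last by move=> [i j] [i' j'] _ _ /= [-> ->].
by rewrite andbT; apply/allpairsP => -[[i j] [_ _]].
Qed.

Lemma ks_profile_tail K n t : ks_profile q (K + n) t <= ks_profile q K t + ks_profile_err K.
Proof.
(* With the error on both sides the induction closes, because [ks_profile_err] loses exactly the
   square of one weight at each step. *)
suff : ks_profile q (K + n) t + ks_profile_err (K + n) <= ks_profile q K t + ks_profile_err K.
  by apply: le_trans; rewrite lerDl divr_ge0// invr_ge0 exprn_ge0.
elim: n => [|n]; first by rewrite addn0.
apply: le_trans; rewrite addnS /ks_profile big_nat_recr//=.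
have -> : ks_profile_err (K + n) = ks_weight (K + n) ^+ 2 + ks_profile_err (K + n).+1.
  rewrite /ks_profile_err /ks_weight exprVn -exprM mulnC exprM.
  have -> : (2 ^+ 2 : R) = 4 by ring.
  by rewrite !exprS; field; rewrite expf_neq0.
have : ks_weight (K + n) ^+ 2 * (set_val t < q (K + n)%N)%R%:R <= ks_weight (K + n) ^+ 2.
  by rewrite ler_piMr ?sqr_ge0//; case: ltP.
lra.
Qed.

Lemma ks_coef_norm x k t : normc (ks_coef q x k t) <= `|x|.
Proof.
rewrite -ler_sqr ?nnegrE ?normc_ge0 ?normr_ge0//.
apply: le_trans (inner_self_le x t).
apply: (ler_cvg_to (cvg_normc_sq (@ks_coef_at x k t)) (cvg_cst _)); apply: nearW => L.
apply: le_trans (normc_CauchySchwarz _ _ _) _; rewrite -[leRHS]mulr1.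
apply: ler_pM; [by apply: sumr_ge0 => i _; exact: sqr_ge0|
  by apply: sumr_ge0 => i _; exact: sqr_ge0| |exact: psi_sum1].
rewrite -(big_map (fun l => idx (Some (k, l))) xpredT (fun i => normc (x i t) ^+ 2)).
by apply: inner_self_ge; rewrite map_inj_uniq ?iota_uniq// => i j /(bij_inj idx_bij)[].
Qed.

Lemma ks_functional_cvg x :
  cvgn (series (fun k => (2 ^- k.+1 : Cx R) *: ks_coef q x k)).
Proof.
apply: C01_series_cvg => e e0.
(* [N + 1] exceeds the quotient and [2 ^+ N] is at least [N + 1], so the geometric tail, of size at
   most [2 ^- N] times the norm of [x], stays below [e]. *)
pose N := Num.truncn (`|x| / e); exists N => n t Nn.
apply: (@le_trans _ _ (\sum_(N <= k < n) ks_weight k * `|x|)).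
  elim/big_rec2: _ => [|k y z _ h]; first by rewrite normc0.
  apply: le_trans (le_normcD _ _) _; rewrite lerD//= ks_weightE normcM normc_real.
  by rewrite ger0_norm ?ks_weight_ge0// ler_wpM2l ?ks_weight_ge0 ?ks_coef_norm.
rewrite -mulr_suml ks_weight_tail//.
apply: (@le_trans _ _ (2 ^- N * `|x|)).
  by rewrite ler_wpM2r// gerBl invr_ge0 exprn_ge0.
rewrite mulrC ler_pdivrMr ?exprn_gt0// mulrC -ler_pdivrMr//.
apply: le_trans (ltW (truncnS_gt _)) _; rewrite -natrX ler_nat.
exact: ltn_expl.
Qed.

Lemma ks_functional_at x t : partial x ^~ t @ \oo --> ks_functional idx q x t.
Proof.
apply: cvgD; first exact: cvg_cst.
have h := C01_lim_at (t := t) (@ks_functional_cvg x).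
have -> : (fun K => \sum_(0 <= k < K) (ks_weight k)%:C * ks_coef q x k t) =
  (fun K => series (fun k => (2 ^- k.+1 : Cx R) *: ks_coef q x k) K t) => //.
apply/funext => K; rewrite /series/= C01_sumE; apply: eq_bigr => k _.
by rewrite /= -ks_weightE.
Qed.

(** The profile at [K] plus the geometric tail dominates all later profiles. Keeping [K] free lets
    finite sums stand for the full squared norm of the functional. *)
Lemma ks_functional_bound x t K :
  normc (ks_functional idx q x t) ^+ 2 <=
  (ks_profile q K t + ks_profile_err K) * normc (inner x x t).
Proof.
apply: (ler_cvg_to (cvg_normc_sq (@ks_functional_at x t)) (cvg_cst _)).
exists K => // n /= Kn; apply: le_trans (partial_bound _ _ _) _.
by rewrite ler_wpM2r ?normc_ge0// -(subnKC Kn) ks_profile_tail.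
Qed.

Lemma ks_functional_norm x : `|ks_functional idx q x| <= 2 * `|x|.
Proof.
apply: C01_norm_le => t; rewrite -ler_sqr ?nnegrE ?normc_ge0 ?mulr_ge0//.
(* At [K = 0] the factor is 1 + 1/3, which is below the square of 2. *)
apply: le_trans (@ks_functional_bound x t 0) _.
rewrite /ks_profile big_geq// addr0 /ks_profile_err expr0 invr1 exprMn.
by apply: ler_pM => //; [exact: normc_ge0|lra|exact: inner_self_le].
Qed.

Lemma ks_coef_linear (a : C01 R) x y k :
  ks_coef q (a *: x + y) k = a * ks_coef q x k + ks_coef q y k.
Proof.
apply/C01_eqP => t; apply: (Cx_cvg_unique (@ks_coef_at _ _ _)
  (cvgD (cvgM (cvg_cst (a t)) (@ks_coef_at x k t)) (@ks_coef_at y k t))) => L /=.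
rewrite !fctE/= mulr_sumr -big_split/=; apply: eq_bigr => l _; ring.
Qed.

Lemma ks_functional_linear (a : C01 R) x y :
  ks_functional idx q (a *: x + y) = a * ks_functional idx q x + ks_functional idx q y.
Proof.
apply/C01_eqP => t; apply: (Cx_cvg_unique (@ks_functional_at _ _)
  (cvgD (cvgM (cvg_cst (a t)) (@ks_functional_at x t)) (@ks_functional_at y t))) => K /=.
rewrite !fctE/= /partial/= mulrDr mulr_sumr addrACA -big_split/=; congr (_ + _).
by apply: eq_bigr => l _; rewrite ks_coef_linear/=; ring.
Qed.

Lemma ks_functional0 : ks_functional idx q 0 = 0.
Proof.
have := ks_functional_linear 1 0 0.
by rewrite scale1r addr0 mul1r => /eqP; rewrite -subr_eq0 opprD addNKr oppr_eq0 => /eqP.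
Qed.

Lemma ks_coef_basis0 k : ks_coef q (ell2_basis R (idx None)) k = 0.
Proof.
rewrite /ks_coef (@lim_series_delta _ _ 0%N) => [|l _];
  by rewrite ell2_basisE (inj_eq (bij_inj idx_bij)) mul0r.
Qed.

Lemma ks_coef_basis1 k l k' :
  ks_coef q (ell2_basis R (idx (Some (k, l)))) k' = if k' == k then ks_psi (q k) l else 0.
Proof.
rewrite /ks_coef (@lim_series_delta _ _ l) => [|j jl].
  rewrite ell2_basisE (inj_eq (bij_inj idx_bij)) ks_psi_star (inj_eq Some_inj) xpair_eqE eqxx andbT.
  by case: eqP => [->|_]; rewrite ?mul1r ?mul0r.
rewrite ell2_basisE (inj_eq (bij_inj idx_bij)) (inj_eq Some_inj) xpair_eqE.
by rewrite (negPf jl) andbF mul0r.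
Qed.

Lemma ks_functional_basis0 : ks_functional idx q (ell2_basis R (idx None)) = 1.
Proof.
rewrite /ks_functional ell2_basisE eqxx -/(ks_coef q _ _) (@lim_series_delta _ _ 0%N) => [|k _].
  by rewrite -/(ks_coef q _ _) ks_coef_basis0 scaler0 addr0.
by rewrite -/(ks_coef q _ _) ks_coef_basis0 scaler0.
Qed.

Lemma ks_functional_basis1 k l : ks_functional idx q (ell2_basis R (idx (Some (k, l)))) =
  (2 ^- k.+1 : Cx R) *: ks_psi (q k) l.
Proof.
rewrite /ks_functional ell2_basisE (inj_eq (bij_inj idx_bij)) add0r.
rewrite (@lim_series_delta _ _ k) => [|j jk].
  by rewrite -/(ks_coef q _ _) ks_coef_basis1 eqxx.
by rewrite -/(ks_coef q _ _) ks_coef_basis1 (negPf jk) scaler0.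
Qed.

End one_sequence.
End functional.

(** * The pair (M_Q, r_Q) for one enumeration: fullness, trivial orthogonal complement, properties
    of the functional *)

Section kaad_skeide_pair.
Variables (R : realType) (idx : option (nat * nat) -> nat) (idx_bij : bijective idx).
Variables (q : nat -> R) (q_enum : ks_enumeration q).
Implicit Types (x y : ell2 R) (t : I01 R).

Let q_gt0 k : 0 < q k.
Proof. by have [_ /(_ k)/andP[]] := q_enum. Qed.

Local Notation e i := (ell2_basis R i).
Local Notation M := (ks_module idx q).
Local Notation r := (ks_functional idx q).

Definition ks_generator k l : ell2 R :=
  (2 ^- k.+1 *: ks_psi (q k) l) *: e (idx None) - e (idx (Some (k, l))).

Lemma ks_generator_coord k l : [/\ ks_generator k l (idx None) = 2 ^- k.+1 *: ks_psi (q k) l,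
  ks_generator k l (idx (Some (k, l))) = -1 &
  forall i, i != idx None -> i != idx (Some (k, l)) -> ks_generator k l i = 0].
Proof.
have E i : ks_generator k l i = (2 ^- k.+1 *: ks_psi (q k) l) * e (idx None) i - e (idx (Some (k, l))) i.
  by [].
split=> [||i i0 i1]; rewrite E !ell2_basisE ?(inj_eq (bij_inj idx_bij)) ?eqxx/=.
- by rewrite mulr1 subr0.
- by rewrite mulr0 sub0r.
- by rewrite (negPf i0) (negPf i1) mulr0 subr0.
Qed.

Lemma inner_generatorr x k l : inner x (ks_generator k l) =
  x (idx None) * C01_star (2 ^- k.+1 *: ks_psi (q k) l) - x (idx (Some (k, l))).
Proof.
have [g0 g1 gi] := ks_generator_coord k l.
rewrite /inner (@lim_series_pair _ _ (idx None) (idx (Some (k, l)))).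
- by rewrite g0 g1 -[-1]sub0r C01_starB C01_star0 C01_star1 sub0r mulrN1.
- by rewrite (inj_eq (bij_inj idx_bij)).
- by move=> i i0 i1; rewrite gi// C01_star0 mulr0.
Qed.

(** Conjugate symmetry for generators, where both series have at most two nonzero terms. *)
Lemma inner_generatorl y k l : inner (ks_generator k l) y = C01_star (inner y (ks_generator k l)).
Proof.
have [g0 g1 gi] := ks_generator_coord k l.
rewrite inner_generatorr C01_starB C01_starM C01_starK.
rewrite /inner (@lim_series_pair _ _ (idx None) (idx (Some (k, l)))).
- by rewrite g0 g1 mulN1r mulrC.
- by rewrite (inj_eq (bij_inj idx_bij)).
- by move=> i i0 i1; rewrite gi// mul0r.
Qed.

Lemma ks_generator_mem k l : M (ks_generator k l).
Proof. by apply: sub_gen_smallest; exists k, l. Qed.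

Lemma ks_module_closed_submodule : closed_submodule M.
Proof.
split.
- by move=> A [[]].
- by move=> a x y Mx My A [cA gA]; have [_ h _] := cA; apply: h; [exact: Mx|exact: My].
- by apply: closed_bigI => A [[]].
Qed.

Lemma ks_functional_ker_closed : closed (functional_ker r).
Proof.
move=> x clx; rewrite /functional_ker/=; apply/normr0_eq0/eqP; rewrite eq_le normr_ge0 andbT.
apply/ler_addgt0Pl => d d0; rewrite addr0.
(* The radius compensates the constant 2 in the norm bound of the functional. *)
have d2 : 0 < d / 2 by rewrite divr_gt0.
have [y [/= ry]] := clx _ (nbhsx_ballx x _ d2).
rewrite -ball_normE /= => xy.
have -> : r x = r (x - y).
  rewrite -(scale1r (x - y)) -[1 *: _]addr0 scalerBr addr0 scale1r addrC -scaleNr.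
  by rewrite ks_functional_linear// ry mulr0 add0r.
apply: le_trans (ks_functional_norm idx_bij q_gt0 _) _.
by rewrite mulrC -ler_pdivlMr// ltW.
Qed.

Lemma ks_functional_ker_closed_submodule : closed_submodule (functional_ker r).
Proof.
split; [exact: (ks_functional0 idx_bij q_gt0)| |exact: ks_functional_ker_closed].
by move=> a x y rx ry; rewrite /functional_ker/= ks_functional_linear// rx ry mulr0 addr0.
Qed.

Lemma ks_functional_generator k l : r (ks_generator k l) = 0.
Proof.
rewrite /ks_generator -scaleN1r addrC ks_functional_linear// ks_functional_basis1//.
rewrite -[X in r X]addr0 ks_functional_linear// ks_functional_basis0//.
by rewrite (ks_functional0 idx_bij q_gt0) mulr1 addr0 mulN1r addNr.
Qed.

Lemma ks_module_sub_ker : M `<=` functional_ker r.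
Proof.
apply: smallest_sub; first exact: ks_functional_ker_closed_submodule.
by move=> _ [k [l ->]]; exact: ks_functional_generator.
Qed.

Lemma ks_weight_psi_at k l t : ((2 ^- k.+1 : Cx R) *: ks_psi (q k) l) t =
  (ks_weight R k * Num.sqrt (ks_psi_sq (q k) l (set_val t)))%:C.
Proof. by rewrite ks_weightE (rmorphM (real_complex R)). Qed.

Lemma ks_weight_psi_star k l : C01_star ((2 ^- k.+1 : Cx R) *: ks_psi (q k) l) =
  (2 ^- k.+1 : Cx R) *: ks_psi (q k) l.
Proof. by apply/C01_eqP => t; rewrite C01_star_at ks_weight_psi_at; exact: conjc_real. Qed.

(** For a single generator [g], [inner g g] is 1 plus a square of a real function, hence invertible
    with an inverse [h]. Every [f] is then the inner product of [(f * h) *: g] and [g], so the span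
    is everything even before closure. *)
Lemma ks_module_full : full_submodule M.
Proof.
rewrite /full_submodule; apply/seteqP; split => // f _; apply: subset_closure.
pose g := ks_generator 0 0.
have [h hg] : exists h, h * inner g g = 1.
  apply: C01_inv => t; have [g0 g1 _] := ks_generator_coord 0 0.
  rewrite inner_generatorr g0 g1 opprK ks_weight_psi_star.
  have -> (a : C01 R) : (a * a + 1) t = a t * a t + 1 by [].
  rewrite ks_weight_psi_at -rmorphM -(rmorph1 (real_complex R)) -rmorphD/=.
  by rewrite fmorph_eq0 gt_eqF// ltr_pwDr// -expr2 sqr_ge0.
exists 1%N, (fun=> 1), (fun=> (f * h) *: g), (fun=> g); split.
  have [M0 MD _] := ks_module_closed_submodule.
  move=> _; split; last exact: ks_generator_mem.
  by rewrite -[_ *: _]addr0; apply: MD => //; exact: ks_generator_mem.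
rewrite big_ord1 scale1r; have [g0 g1 _] := ks_generator_coord 0 0.
rewrite -[LHS]mulr1 -hg mulrA !inner_generatorr.
have -> i : ((f * h) *: g) i = f * h * g i by [].
by rewrite mulrBr mulrA.
Qed.

(** Orthogonality is asked for the generators only, so the result serves both [M] and a vector
    representing a multiple of [r]. *)
Lemma ks_generators_orth x : orth_compl (ks_generators idx q) x -> x = 0.
Proof.
move=> xM.
have xE k l : x (idx (Some (k, l))) = x (idx None) * (2 ^- k.+1 *: ks_psi (q k) l).
  have /eqP : inner x (ks_generator k l) = 0 by apply: xM; exists k, l.
  by rewrite inner_generatorr subr_eq0 ks_weight_psi_star => /eqP <-.
have x_node k t : set_val t = q k -> x (idx None) t = 0.
  move=> tk; apply/eq0_normc/eqP; rewrite eq_le normc_ge0 andbT.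
  apply/ler_addgt0Pl => d d0; rewrite addr0.
  have d2 : 0 < d / 2 by rewrite divr_gt0.
  have [d' d'0 near_t] := I01_near (x (idx None)) t d2.
  have [J JP] := ks_node_near (q_gt0 k) d'0.
  (* At a node the corresponding [psi] is 1, so the entry of [x] there is [ks_weight R k] times
     [x (idx None)]; the same factor in the tolerance cancels it. *)
  have [|N NP] := @ell2_tail R x ((ks_weight R k * (d / 2)) ^+ 2).
    by rewrite exprn_gt0// mulr_gt0// invr_gt0 exprn_gt0.
  have [m mP] := idx_tail idx_bij k N.
  (* Beyond [J] the node is close to [q k]; beyond [m] the position lies in the small tail of
     [x]. *)
  pose j := maxn J m.
  have [s sj] : exists s : I01 R, set_val s = ks_node (q k) j.
    apply: I01_mk; rewrite ks_node_ge0//= ltW// (lt_trans (ks_node_lt_q _ _))//.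
    by have [_ /(_ k)/andP[]] := q_enum.
  have := NP [:: idx (Some (k, j))] s isT; rewrite /= mP ?leq_maxr// => /(_ isT).
  have wd0 : 0 <= ks_weight R k * (d / 2) by rewrite mulr_ge0 ?ks_weight_ge0// ltW.
  rewrite big_seq1 ler_sqr ?nnegrE ?normc_ge0//.
  rewrite xE /= -/(ks_psi _ _) sj ks_psi_sq_node// sqrtr1 mulr1 ks_weightE.
  rewrite mulrC normcM normc_real ger0_norm ?ks_weight_ge0//.
  rewrite ler_pM2l ?invr_gt0 ?exprn_gt0// => xs.
  have /near_t ts : `|set_val t - set_val s| < d'.
    rewrite tk sj ger0_norm; first by apply: JP; exact: leq_maxl.
    by rewrite subr_ge0 ltW// ks_node_lt_q.
  rewrite -(subrK (x (idx None) s) (x (idx None) t)).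
  by apply: le_trans (le_normcD _ _) _; rewrite [leRHS]splitr lerD// ltW.
(* A continuous function that vanishes on the dense set of the [q k] is zero. *)
have x0 : x (idx None) = 0.
  apply/C01_eqP => t; apply/eq0_normc/eqP; rewrite eq_le normc_ge0 andbT.
  apply/ler_addgt0Pl => d d0; rewrite addr0.
  have [d' d'0 near_t] := I01_near (x (idx None)) t d0.
  have [_ q01 /(_ (set_val t) (set_valP t)) clt] := q_enum.
  have [_ [[k _ <-]]] := clt _ (nbhsx_ballx (set_val t) _ d'0).
  rewrite -ball_normE/= => tk.
  have [s sk] : exists s : I01 R, set_val s = q k.
    by apply: I01_mk; have /andP[/ltW -> /ltW ->] := q01 k.
  have := near_t s; rewrite sk (x_node k s sk) subr0 => /(_ tk); exact: ltW.
apply/ell2_eqP => i; have [g gK Kg] := idx_bij; rewrite -(Kg i).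
by case: (g i) => [[k l]|]; rewrite ?xE x0 ?mul0r.
Qed.

Lemma orth_compl_ks_module : orth_compl M = [set 0].
Proof.
apply/seteqP; split => [x xM|_ ->]; last by move=> y _; exact: inner0l.
by apply: ks_generators_orth => _ [k [l ->]]; apply: xM; exact: ks_generator_mem.
Qed.

Lemma ks_functional_pair :
  [/\ nondegenerate_functional r,
      range (fun b => dual_scale b r) `&` range (@dual_embed R) = [set cst 0]
    & ~ biorthogonally_complemented (functional_ker r)].
Proof.
have r1 : r (e (idx None)) = 1 by rewrite ks_functional_basis0.
split.
- move=> a; split => [/(congr1 (fun f => f (e (idx None))))|->].
    by rewrite /dual_scale r1 mul1r => /(congr1 (@C01_star R)); rewrite C01_starK C01_star0.
  by apply/funext => x; rewrite /dual_scale C01_star0 mulr0.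
- apply/seteqP; split => [_ [[a _ <-] [y _ ay]]|_ ->].
    (* If a multiple of [r] is represented by [y], then [y] is orthogonal to all generators, since
       [r] kills them. *)
    suff y0 : y = 0 by rewrite -ay y0; apply/funext => x; exact: inner0r.
    apply: ks_generators_orth => _ [k [l ->]].
    rewrite -[inner _ _]C01_starK -inner_generatorl.
    have := congr1 (fun f => f (ks_generator k l)) ay.
    by rewrite /dual_embed /dual_scale ks_functional_generator mul0r => ->; exact: C01_star0.
  split; first by exists 0 => //; apply/funext => x; rewrite /dual_scale C01_star0 mulr0.
  by exists 0 => //; apply/funext => x; exact: inner0r.
(* The kernel contains [M], so its orthogonal complement is 0 and its biorthogonal complement is the
   whole module; but [r] takes the value 1 at this basis vector. *)
- move=> bc; suff : functional_ker r (e (idx None)).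
    by rewrite /functional_ker/= r1 => /eqP; rewrite oner_eq0.
  rewrite bc => m mr; suff -> : m = 0 by exact: inner0r.
  have : orth_compl M m by move=> x /ks_module_sub_ker; exact: mr.
  by rewrite orth_compl_ks_module.
Qed.

End kaad_skeide_pair.

(** * The fibrewise squared norm as a unitary invariant, and recovery of the enumeration from its
    jumps *)

Section profile.
Variables (R : realType) (idx : option (nat * nat) -> nat) (idx_bij : bijective idx).
Implicit Types (x y : ell2 R) (t : I01 R) (p q : nat -> R).

Lemma ks_functional_sum q (a : nat -> C01 R) n : (forall k, 0 < q k) ->
  ks_functional idx q (\sum_(0 <= i < n) a i *: ell2_basis R i) =
  \sum_(0 <= i < n) a i * ks_functional idx q (ell2_basis R i).
Proof.
move=> q0; elim: n => [|n IH]; first by rewrite !big_geq// (ks_functional0 idx_bij q0).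
by rewrite !big_nat_recr//= addrC ks_functional_linear// IH addrC.
Qed.

(* The test vectors are the truncations of the vector representing the functional. *)
Lemma coefficients_le_profile q p (W : ell2 R -> ell2 R) K n t :
  (forall k, 0 < q k) -> (forall k, 0 < p k) ->
  (forall x, inner (W x) (W x) = inner x x) ->
  (forall x, ks_functional idx p (W x) = ks_functional idx q x) ->
  \sum_(0 <= i < n) normc (ks_functional idx q (ell2_basis R i) t) ^+ 2 <=
  ks_profile p K t + ks_profile_err R K.
Proof.
move=> q0 p0 Wi Wr; pose c i := ks_functional idx q (ell2_basis R i).
set s := \sum_(0 <= i < n) _.
pose x := \sum_(0 <= i < n) C01_star (c i) *: ell2_basis R i.
have cE i : (C01_star (c i) * c i) t = (normc (c i t) ^+ 2)%:C.
  by rewrite mulrC; exact: mul_conjc.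
have rx : ks_functional idx q x t = s%:C.
  by rewrite ks_functional_sum// C01_sumE rmorph_sum; apply: eq_bigr => i _; exact: cE.
have ix : inner x x t = s%:C.
  rewrite /inner (@lim_series_finite _ _ n) => [|i ni]; last first.
    by rewrite ell2_sum_coord ltnNge ni mul0r.
  rewrite C01_sumE rmorph_sum [RHS]big_mkord; apply: eq_bigr => i _.
  by rewrite ell2_sum_coord ltn_ord C01_starK cE.
have s0 : 0 <= s by apply: sumr_ge0 => i _; exact: sqr_ge0.
have P0 : 0 <= ks_profile p K t + ks_profile_err R K.
  rewrite addr_ge0//; last by rewrite divr_ge0// invr_ge0 exprn_ge0.
  by rewrite addr_ge0// sumr_ge0// => k _; rewrite mulr_ge0 ?sqr_ge0.
(* Both [r x] and [inner x x] have the value [s] at [t], so the bound bounds [s ^+ 2] by a multiple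
   of [s]; it remains to divide by [s], with [P0] for the case [s = 0]. *)
have := ks_functional_bound idx_bij p0 (W x) t K.
rewrite Wi Wr rx ix !normc_real ger0_norm// expr2.
move: s0; rewrite le_eqVlt => /orP[/eqP <-//|s0].
by rewrite ler_pM2r.
Qed.

(** At a fixed [t] each block attains its indicator after finitely many hats, so the first [K]
    blocks are accounted for by finitely many basis vectors. *)
Lemma profile_le_coefficients q K t : (forall k, 0 < q k) ->
  exists n, ks_profile q K t <=
    \sum_(0 <= i < n) normc (ks_functional idx q (ell2_basis R i) t) ^+ 2.
Proof.
move=> q0; have /andP[t0 _] := I01_bounds t.
have [L LP] := choice (fun k => ks_psi_sq_sum_eq (q0 k) t0).
pose s := None :: [seq Some (k, l) | k <- index_iota 0 K, l <- index_iota 0 (L k)].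
have us : uniq (map idx s).
  rewrite map_inj_uniq; last exact: bij_inj.
  rewrite /s/= allpairs_uniq_dep ?iota_uniq//; last by move=> [i j] [i' j'] _ _ /= [-> ->].
  - by rewrite andbT; apply/allpairsPdep => -[i [j [_ _]]].
  - by move=> i _; rewrite iota_uniq.
pose c i := normc (ks_functional idx q (ell2_basis R i) t) ^+ 2.
have [i||n _ le] := @big_uniq_le R c _ 0 _ us; [exact: sqr_ge0|exact/allP|].
exists n; apply: le_trans le; rewrite big_map big_cons big_allpairs_dep.
rewrite /c ks_functional_basis0// normc1 expr1n lerD2l; apply: ler_sum => k _.
rewrite -LP big_mkord mulr_sumr; apply: ler_sum => l _.
rewrite ks_functional_basis1// ks_weight_psi_at normc_real real_normK ?num_real//.
by rewrite exprMn sqr_sqrtr// ks_psi_sq_ge0.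
Qed.

Lemma profile_le q p (W : ell2 R -> ell2 R) K t :
  (forall k, 0 < q k) -> (forall k, 0 < p k) ->
  (forall x, inner (W x) (W x) = inner x x) ->
  (forall x, ks_functional idx p (W x) = ks_functional idx q x) ->
  ks_profile q K t <= ks_profile p K t + ks_profile_err R K.
Proof.
move=> q0 p0 Wi Wr; have [n le] := profile_le_coefficients K t q0.
by apply: le_trans le _; exact: (coefficients_le_profile _ _ _ q0 p0 Wi Wr).
Qed.

(* The profile of q jumps by 4^-(k+1) at q k; the jump of the profile of p there
   can only come from some p j with j <= k. *)
Lemma profile_jump q p : injective p -> (forall k, 0 < q k < 1) ->
  (forall K t, ks_profile q K t <= ks_profile p K t + ks_profile_err R K) ->
  (forall K t, ks_profile p K t <= ks_profile q K t + ks_profile_err R K) ->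
  forall k, exists2 j, (j <= k)%N & p j = q k.
Proof.
move=> p_inj q01 qp pq k; apply: contrapT => noj.
have pj j : (j <= k)%N -> p j != q k by move=> jk; apply/eqP => pjk; apply: noj; exists j.
have /andP[c0 c1] := q01 k; set c := q k in pj c0 c1 *.
pose f (j : 'I_k.+2) : R := if p j < c then p j else 0.
(* No [p j] with [j < k.+2] lies strictly between [s] and [c]. The value 0 stands in when no such
   [p j] is below [c]. *)
pose s := \big[Num.max/0]_(j < k.+2) f j.
have sc : s < c.
  by apply/bigmax_ltP; split => // j _; rewrite /f; case: ifP.
have s0 : 0 <= s by exact: bigmax_ge_id.
have ps j : (j < k.+2)%N -> p j < c -> p j <= s.
  by move=> jk pc; have := @le_bigmax _ _ _ 0 f (Ordinal jk); rewrite /f /= pc.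
have [tc tcE] : exists t : I01 R, set_val t = c by apply: I01_mk; rewrite !ltW.
have [ts tsE] : exists t : I01 R, set_val t = s by apply: I01_mk; rewrite s0/= ltW// (lt_trans sc).
(* Put d = 4^-(k+2). From [s] to [c] the profile of [q] drops by at least 4d, that of [p] by at most
   d, through the index [k.+1] alone. The two errors add up to 2d/3, a contradiction. *)
have := qp k.+2 ts; have := pq k.+2 tc; rewrite /ks_profile tcE tsE.
have h1 : \sum_(0 <= j < k.+2) ks_weight R j ^+ 2 * (c < q j)%R%:R + ks_weight R k ^+ 2 <=
    \sum_(0 <= j < k.+2) ks_weight R j ^+ 2 * (s < q j)%R%:R.
  rewrite -lerBrDl -sumrB (bigD1_seq k) ?iota_uniq ?mem_index_iota ?leqnSn//=.
  rewrite -/c ltxx sc mulr0 mulr1 subr0 lerDl sumr_ge0// => j _.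
  rewrite -mulrBr mulr_ge0 ?sqr_ge0// subr_ge0 ler_nat.
  by case: (ltP c (q j)) => // cq; rewrite (lt_trans sc).
have h2 : \sum_(0 <= j < k.+2) ks_weight R j ^+ 2 * (s < p j)%R%:R <=
    \sum_(0 <= j < k.+2) ks_weight R j ^+ 2 * (c < p j)%R%:R + ks_weight R k.+1 ^+ 2.
  rewrite !(big_nat_recr k.+1)//= -addrA lerD//.
    rewrite big_nat_cond [leRHS]big_nat_cond; apply: ler_sum => j /andP[/andP[_ jk] _].
    rewrite ler_wpM2l ?sqr_ge0// ler_nat; case: (ltgtP c (p j)) => [_|pc|/eqP].
      exact: leq_b1.
      by rewrite ltNge (ps _ (leqW jk) pc).
    by rewrite eq_sym (negPf (pj _ _)).
  apply: ler_wpDl; first by rewrite mulr_ge0// sqr_ge0.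
  by rewrite ler_piMr ?sqr_ge0//; case: ltP.
have wE j : ks_weight R j ^+ 2 = 4 ^- j.+1.
  rewrite /ks_weight exprVn -exprM mulnC exprM.
  by have -> : (2 ^+ 2 : R) = 4 by ring.
rewrite !wE /ks_profile_err in h1 h2 *.
have : 4 ^- k.+1 = 4 * 4 ^- k.+2 :> R by rewrite [in RHS]exprS; field; rewrite expf_neq0.
have : 0 < 4 ^- k.+2 :> R by rewrite invr_gt0 exprn_gt0.
lra.
Qed.

Lemma profile_inj q p : injective q -> injective p ->
  (forall k, 0 < q k < 1) -> (forall k, 0 < p k < 1) ->
  (forall K t, ks_profile q K t <= ks_profile p K t + ks_profile_err R K) ->
  (forall K t, ks_profile p K t <= ks_profile q K t + ks_profile_err R K) ->
  q = p.
Proof.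
move=> q_inj p_inj q01 p01 qp pq; apply/funext => k.
(* Going from [q] to [p] and back never raises the index. Injectivity of [q] brings it back to [k],
   so it never dropped either. *)
have [j jk pj] := profile_jump p_inj q01 qp pq k.
have [i ij qi] := profile_jump q_inj p01 pq qp j.
have ik : i = k by apply: q_inj; rewrite qi.
have jkE : j = k by apply/eqP; rewrite eqn_leq jk -{1}ik.
by rewrite -pj jkE.
Qed.

Lemma unitarily_isomorphic_ks q p (M1 M2 : set (ell2 R)) :
  ks_enumeration q -> ks_enumeration p ->
  unitarily_isomorphic M1 (ks_functional idx q) M2 (ks_functional idx p) -> q = p.
Proof.
move=> [q_inj q01 _] [p_inj p01 _] [U [V [[[_ _ UV] VK UK] _ rE]]].
have q0 k : 0 < q k by have /andP[] := q01 k.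
have p0 k : 0 < p k by have /andP[] := p01 k.
apply: profile_inj => // K t.
  apply: (@profile_le _ _ U) => // x; first by rewrite UV VK.
  by rewrite rE/= VK.
by apply: (@profile_le _ _ V) => // x; [rewrite -UV UK|rewrite rE].
Qed.

End profile.

(** * A continuum of enumerations, and uncountably many distinct dense sets *)

Section enumerations.
Variable R : realType.
Implicit Types (a c : R).

Lemma card_le_inj T U (A : set T) (B : set U) (f : T -> U) :
  set_fun A B f -> set_inj A f -> (A #<= B)%card.
Proof.
move=> fAB fi; have [g] : $|{injfun A >-> B}| by apply/injfunPex; exists f.
exact: inj_card_le g.
Qed.

Definition rat01 : set R := [set x | 0 < x < 1] `&` range (@ratr R).

Lemma countable_rat01 : countable rat01.
Proof.
apply: (@sub_countable _ _ _ (range (@ratr R))); last first.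
  by apply: card_le_trans (card_image_le _ _) _; exact: countableP.
by apply: subset_card_le => x [].
Qed.

Lemma infinite_rat01 : infinite_set rat01.
Proof.
apply/infiniteP; apply: (@card_le_inj _ _ _ _ (fun n : nat => n.+2%:R^-1)).
  move=> n _; split => /=; last by exists (n.+2%:R^-1) => //; rewrite fmorphV rmorph_nat.
  by rewrite invr_gt0 ltr0n/= invf_lt1 ?ltr0n// ltr1n.
by move=> m n _ _ /invr_inj/eqP; rewrite eqr_nat => /eqP [].
Qed.

Lemma rat01_dense (x e : R) : 0 <= x <= 1 -> 0 < e ->
  exists2 y, rat01 y & `|x - y| < e.
Proof.
move=> /andP[x0 x1] e0.
have /rat_in_itvoo[r] : Num.max 0 (x - e) < Num.min 1 (x + e).
  by rewrite gt_max !lt_min; lra.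
rewrite in_itv/= gt_max lt_min => /andP[/andP[r0 rl] /andP[r1 ru]].
exists (ratr r); first by split; [rewrite /= r0 r1|exists r].
by rewrite ltr_norml; lra.
Qed.

(** The point [c] comes first, followed by an enumeration of the other rationals of ]0, 1[; removing
    [c] from these keeps the sequence injective when [c] is rational. *)
Lemma ks_enumeration_from c : 0 < c < 1 ->
  exists q, [/\ ks_enumeration q, q 0%N = c & range q = c |` rat01].
Proof.
move=> c01; pose D := rat01 `\ c.
have cD : countable D by apply: sub_countable countable_rat01; by apply: subset_card_le => x [].
have iD : infinite_set D.
  apply: infinite_setD; [exact: infinite_rat01|exact: finite_set1].
have /card_set_bijP[h [hf hi hs]] : ([set: nat] #= D)%card.
  by rewrite card_eq_le; apply/andP; split => //; exact/infiniteP.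
exists (fun n => if n is m.+1 then h m else c).
have rq : range (fun n => if n is m.+1 then h m else c) = c |` rat01.
  apply/seteqP; split => [_ [[|n] _ <-]|x [->|xD]].
  - by left.
  - by right; have [] := hf n I.
  - by exists 0%N.
  - have [->|xc] := pselect (x = c); first by exists 0%N.
    by have [|n _ <-] := hs x; [|exists n.+1].
split=> //; split.
- move=> [|m] [|n] //.
  + by move=> cE; have [_ /=] := hf n I; rewrite -cE.
  + by move=> cE; have [_ /=] := hf m I; rewrite cE.
  + by move=> /(hi _ _ (mem_setT _) (mem_setT _)) ->.
- by move=> [|n] //; have [[]] := hf n I.
- move=> x; rewrite /= in_itv/= => x01 B /nbhs_ballP[e /= e0 eB].
  have [y yD xy] := rat01_dense x01 e0.
  exists y; split; first by rewrite rq; right.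
  by apply: eB; rewrite -ball_normE.
Qed.

(** A decreasing logistic function, which makes every real number the index of a first point in ]0,
    1[. *)
Definition to01 a : R := (1 + expR a)^-1.

Lemma to01_bounds a : 0 < to01 a < 1.
Proof.
have e0 := expR_gt0 a.
by rewrite /to01 invr_gt0 addr_gt0//= invf_lt1 ?addr_gt0// ltrDl.
Qed.

Lemma to01_inj : injective to01.
Proof. by move=> a b /invr_inj/addrI/expR_inj. Qed.

(** Otherwise the line would be a union of two countable sets, against the Lebesgue measure of
    [0, 1]. *)
Lemma uncountable_irrational : ~ countable [set a | ~ rat01 (to01 a)].
Proof.
move=> cI.
have cQ : countable [set a | rat01 (to01 a)].
  apply: card_le_trans countable_rat01; apply: (@card_le_inj _ _ _ _ to01) => //.
  by move=> x y _ _; exact: to01_inj.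
have : countable (\bigcup_(b in [set: bool]) [set a | rat01 (to01 a) <-> b]).
  apply: bigcup_countable => // -[] _.
    by apply: sub_countable cQ; apply: subset_card_le => a [_]; exact.
  by apply: sub_countable cI; apply: subset_card_le => a [h _] /h.
have -> : \bigcup_(b in [set: bool]) [set a | rat01 (to01 a) <-> b] = [set: R].
  by apply/seteqP; split => // a _; exists `[< rat01 (to01 a) >] => //=; split => /asboolP.
move=> /(sub_countable (subset_card_le (@subsetT _ `[(0 : R), 1]%classic))).
move=> /countable_lebesgue_measure0; rewrite lebesgue_measure_itv/= lte_fin ltr01.
by rewrite -EFinD subr0 => /eqP; rewrite eqe oner_eq0.
Qed.

End enumerations.

(** * The family of pairs indexed by the real line *)

Theorem theorem5p5 (R : realType) (idx : option (nat * nat) -> nat)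
    (idx_bij : bijective idx) :
  exists (I : Type) (M : I -> set (ell2 R)) (r : I -> ell2 R -> C01 R),
    ([set: I] #= [set: R])%card /\
    (forall a,
       [/\ closed_submodule (M a), full_submodule (M a) & orth_compl (M a) = [set 0]]) /\
    (forall a,
       [/\ r a <> cst 0, bounded_functional (r a)
         & forall x, M a x -> r a x = 0]) /\
    (forall a,
       [/\ nondegenerate_functional (r a),
           range (fun b => dual_scale b (r a)) `&` range (@dual_embed R)
             = [set cst 0],
           closed (functional_ker (r a))
         & ~ biorthogonally_complemented (functional_ker (r a))]) /\
    (forall a b, a <> b -> ~ unitarily_isomorphic (M a) (r a) (M b) (r b)) /\
    exists (J : set I) (q : I -> nat -> R),
      [/\ ~ countable J,
          (forall a, J a ->
             [/\ ks_enumeration (q a), M a = ks_module idx (q a)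
               & r a = ks_functional idx (q a)])
        & forall a b, J a -> J b -> a <> b -> range (q a) <> range (q b)].
Proof.
have [q qP] := choice (fun a : R => ks_enumeration_from (to01_bounds a)).
have q_enum a : ks_enumeration (q a) by have [] := qP a.
(* The index is read off from the first point. Enumerations with the same range thus still differ,
   as happens for rational first points. *)
have q_inj a b : q a = q b -> a = b.
  move=> ab; apply: to01_inj; have [_ <- _] := qP a; have [_ <- _] := qP b.
  by rewrite ab.
exists R, (fun a => ks_module idx (q a)), (fun a => ks_functional idx (q a)).
have q0 a k : 0 < q a k by have [_ /(_ k)/andP[]] := q_enum a.
split; first exact: card_eqxx.
split=> [a|].
  split; [exact: ks_module_closed_submodule|exact: ks_module_full|exact: orth_compl_ks_module].
split=> [a|].
  split.
  - move=> /(congr1 (fun f => f (ell2_basis R (idx None)))).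
    by rewrite ks_functional_basis0//= => /eqP; rewrite oner_eq0.
  - split; first by move=> c x y; exact: ks_functional_linear.
    by exists 2 => x; exact: ks_functional_norm.
  - exact: ks_module_sub_ker.
split=> [a|].
  have [nd ri bc] := ks_functional_pair idx_bij (q_enum a).
  by split => //; exact: ks_functional_ker_closed.
split=> [a b ab iso|].
  by apply/ab/q_inj; exact: (unitarily_isomorphic_ks idx_bij (q_enum a) (q_enum b) iso).
(* An irrational first point is the only irrational point of its range, so on this index set the
   ranges themselves differ. *)
exists [set a | ~ rat01 (to01 a)], q; split; [exact: uncountable_irrational|by []|].
move=> a b aI bI ab; have [_ _ ->] := qP a; have [_ _ ->] := qP b => E.
have : (to01 b |` @rat01 R) (to01 a) by rewrite -E; left.
by move=> [/to01_inj|].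
Qed.
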